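(* Let $p = 2j/(2j-1)$ for some integer $j>1$. Let $G$ be a function in $L^{2j}$ with nonnegative coefficients, that is, $\hat G(n) \ge 0$ for all integers $n$, and let $F = (\overline G)^{j-1}G^j$. Let $f$ be any function in $L^p$ with the property that $|\hat f(n)| \ge \hat F(n)$ for every integer $n$ in the support of $\hat G$. Then $\|f\|_p \ge \|F\|_p$.
   Context: $L^p$ denotes the space of complex-valued ($2\pi$-periodic) functions on $[-\pi,\pi)$ with norm $\|f\|_p = \left(\frac{1}{2\pi}\int_{-\pi}^{\pi}|f(\theta)|^p\,d\theta\right)^{1/p}$, and $\hat f(n) = \frac{1}{2\pi}\int_{-\pi}^\pi f(\theta)e^{-in\theta}\,d\theta$ for integers $n$. The support of $\hat G$ is $\{n\in\mathbb{Z}: \hat G(n)\neq 0\}$. (If $\hat G \ge 0$ then $\hat F$ is real and nonnegative, so the inequality makes sense.) *)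

(* Defs.v *)
From HB Require Import structures.
From mathcomp Require Import all_boot all_order all_algebra.
From mathcomp Require Import complex.
From mathcomp Require Import all_classical all_reals all_analysis.

Set Implicit Arguments.
Unset Strict Implicit.
Unset Printing Implicit Defensive.

Import Order.TTheory GRing.Theory Num.Theory.
Import ComplexField.Normc.

Local Open Scope classical_set_scope.
Local Open Scope complex_scope.
Local Open Scope ring_scope.

Definition circle {R : realType} : set R := `[- pi, pi[.

(* exp (i t) *)
Definition cexpi {R : realType} (t : R) : R[i] := cos t +i* sin t.

Definition cintegral {R : realType} (D : set R) (f : R -> R[i]) : R[i] :=
  (\int[lebesgue_measure]_(t in D) complex.Re (f t))
    +i* (\int[lebesgue_measure]_(t in D) complex.Im (f t)).

(* [R[i]] carries the partial order in which [x <= y] iff [y - x] is a nonnegative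
   real; so [0 <= fourier f n] says that the coefficient is real and nonnegative. *)
Definition fourier {R : realType} (f : R -> R[i]) (n : int) : R[i] :=
  ((2 * pi)^-1)%:C * cintegral circle (fun t => f t * cexpi (- (n%:~R * t))).

(* The value is [+oo] when the integral diverges. *)
Definition cLnorm {R : realType} (p : R) (f : R -> R[i]) : \bar R :=
  (((2 * pi)^-1)%:E *
    \int[lebesgue_measure]_(t in circle) (normc (f t) `^ p)%:E)%E `^ p^-1.

(* Elements of L^p are represented by 2 pi-periodic functions on the whole
   line; almost everywhere equal representatives are not identified.
   Measurability of a complex function is that of its real and imaginary parts,
   with respect to the Borel sets of R. *)
Definition inLp {R : realType} (p : R) (f : R -> R[i]) : Prop :=
  [/\ periodic f (2 * pi),
      measurable_fun circle (fun t => complex.Re (f t)),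
      measurable_fun circle (fun t => complex.Im (f t)) &
      (cLnorm p f < +oo)%E].

(* Main.v *)
Require Import Defs.
From mathcomp Require Import all_boot all_order all_algebra.
From mathcomp Require Import complex.
From mathcomp Require Import all_classical all_reals all_analysis.
From mathcomp Require Import measurable_realfun.
From mathcomp Require Import zify ring lra.

Import Order.TTheory GRing.Theory Num.Theory.

Local Open Scope ring_scope.

(** Write <u, v> for the mean over the circle of u times the conjugate of v, and
    put q = 2 j, the exponent conjugate to p. Since |F|^p = |G|^q and F times the
    conjugate of G is |G|^q, the p-th power of the norm of F is <F, G>. Formally,
    Parseval and the hypotheses give
      <F, G> = sum_n F^(n) G^(n) <= sum_n |f^(n)| G^(n) = <f, g>,
    where g^(n) is G^(n) times the phase of f^(n). Young's inequality [young_mean_le]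
    bounds <f, g> by |f|_p^p / p + |g|_q^q / q. Here |g|_q <= |G|_q, because q is
    even: |g|_q^q is the zeroth coefficient of g^j conj(g^j), the coefficients of a
    product are convolutions, and those of g are bounded in modulus by those of G.
    Hence I <= J / p + I / q, with I and J the p-th powers of the norms of F and f,
    and this says I <= J.

    To make this rigorous only products of two square-integrable functions are ever
    expanded; these are enough because G^k is square-integrable for k <= j. For such
    products the convolution formula holds as a limit of finite sums [fourierM_cvg],
    so coefficientwise majorization is compatible with products [majM]. Parseval for
    <F, G>, where F need not be square-integrable, is avoided: all coefficients in
    sight are nonnegative, so replacing G by a partial sum G_N in one factor, or G^j
    by a partial sum, can only decrease the zeroth coefficient of
    G^j conj(G^(j-1) G_N). This gives, uniformly in M and N, the bound
      sum_(|m| <= M) (G^j)^(m) (G^(j-1) G_N)^(m) <= J / p + I / q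
    (up to the factor 1 / (2 pi)), in which first N and then M tend to infinity
    [dual_majorant].

    The analytic input is the L2 convergence of Fourier series, which by
    orthogonality amounts to the density of trigonometric polynomials
    [L2_in_closure]. That is obtained from arcs: an arc is the positivity set of a
    trigonometric polynomial of degree one, and composing the latter with polynomials
    that approach a step function gives the indicator of the arc in the limit.
    Dynkin's theorem and simple functions do the rest. *)

(** * Complex numbers *)

Section ComplexNumbers.
Import ComplexField.Normc.
Local Open Scope complex_scope.
Context {R : realType}.
Implicit Types (x y z : R[i]) (a b : R).

Lemma complexP x y : complex.Re x = complex.Re y -> complex.Im x = complex.Im y -> x = y.
Proof. by case: x y => [a b] [c d] /= -> ->. Qed.

Lemma reD x y : complex.Re (x + y) = complex.Re x + complex.Re y.
Proof. by case: x y => [a b] [c d]. Qed.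

Lemma imD x y : complex.Im (x + y) = complex.Im x + complex.Im y.
Proof. by case: x y => [a b] [c d]. Qed.

Lemma reN x : complex.Re (- x) = - complex.Re x.
Proof. by case: x. Qed.

Lemma imN x : complex.Im (- x) = - complex.Im x.
Proof. by case: x. Qed.

Lemma reM x y : complex.Re (x * y) =
  complex.Re x * complex.Re y - complex.Im x * complex.Im y.
Proof. by case: x y => [a b] [c d]. Qed.

Lemma imM x y : complex.Im (x * y) =
  complex.Re x * complex.Im y + complex.Im x * complex.Re y.
Proof. by case: x y => [a b] [c d]. Qed.

Lemma reJ x : complex.Re x^*%C = complex.Re x.
Proof. by case: x. Qed.

Lemma imJ x : complex.Im x^*%C = - complex.Im x.
Proof. by case: x. Qed.

Lemma normc_ge0 x : 0 <= normc x.
Proof. by case: x => a b; exact: sqrtr_ge0. Qed.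

Lemma normc_sqr x : normc x ^+ 2 = complex.Re x ^+ 2 + complex.Im x ^+ 2.
Proof. by case: x => a b /=; rewrite sqr_sqrtr// addr_ge0// sqr_ge0. Qed.

Lemma normr_normc x : `|x| = (normc x)%:C.
Proof. by case: x. Qed.

Lemma normc_triangle x y : normc (x + y) <= normc x + normc y.
Proof. by rewrite -lecR rmorphD/= -!normr_normc ler_normD. Qed.

Lemma normc_conj x : normc x^*%C = normc x.
Proof. by case: x => a b /=; rewrite sqrrN. Qed.

Lemma normc_real a : normc a%:C = `|a|.
Proof. by rewrite /= expr0n/= addr0 sqrtr_sqr. Qed.

Lemma normcX x n : normc (x ^+ n) = normc x ^+ n.
Proof.
elim: n => [|n IH]; first by rewrite !expr0 normc1.
by rewrite !exprS normcM IH.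
Qed.

Lemma normr_Re_le x : `|complex.Re x| <= normc x.
Proof.
rewrite -ler_sqr ?nnegrE ?normc_ge0// normc_sqr real_normK ?num_real//.
by rewrite lerDl sqr_ge0.
Qed.

Lemma normr_Im_le x : `|complex.Im x| <= normc x.
Proof.
rewrite -ler_sqr ?nnegrE ?normc_ge0// normc_sqr real_normK ?num_real//.
by rewrite lerDr sqr_ge0.
Qed.

Lemma mulcJ_normc x : x * x^*%C = (normc x ^+ 2)%:C.
Proof. by rewrite normc_sqr; apply: complexP; case: x => a b /=; ring. Qed.

Lemma realcM a b : (a * b)%:C = a%:C * b%:C.
Proof. exact: rmorphM. Qed.

Lemma conjcD x y : (x + y)^*%C = x^*%C + y^*%C.
Proof. exact: rmorphD. Qed.

Lemma conjcM x y : (x * y)^*%C = x^*%C * y^*%C.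
Proof. exact: rmorphM. Qed.

Lemma normc_sqrD x y : normc (x + y) ^+ 2 =
  normc x ^+ 2 + normc y ^+ 2 + 2 * complex.Re (x * y^*%C).
Proof. by rewrite !normc_sqr; case: x y => [a b] [c d] /=; ring. Qed.

Lemma normc_sqrD_le x y : normc (x + y) ^+ 2 <= 2 * normc x ^+ 2 + 2 * normc y ^+ 2.
Proof.
rewrite !normc_sqr; case: x y => [a b] [c d] /=.
have := sqr_ge0 (a - c); have := sqr_ge0 (b - d); lra.
Qed.

(** The complex order makes [|x| <= y] say in particular that [y] is real, so
    its stability under limits includes the fact that reals are closed. *)
Lemma ler_norm_lim x y :
  (forall e : R, 0 < e -> exists x' y',
    [/\ `|x'| <= y', normc (x - x') <= e & normc (y - y') <= e]) -> `|x| <= y.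
Proof.
move=> H; rewrite normr_normc lecE.
have Hi : complex.Im y = 0.
  apply/eqP; rewrite -normr_le0; apply/ler_addgt0Pl => e e0; rewrite addr0.
  have [x' [y' [xy _ ye]]] := H _ e0.
  apply: le_trans ye; apply: le_trans (normr_Im_le _).
  move: xy; rewrite normr_normc lecE => /andP[/eqP iy _].
  by rewrite imD imN iy /= subr0.
rewrite Hi eqxx /=; apply/ler_addgt0Pl => e e0.
have [x' [y' [xy xe ye]]] := H (e / 2) (divr_gt0 e0 (ltr0n _ 2)).
have h1 : normc x <= normc (x - x') + normc x'.
  by rewrite -{1}(subrK x' x) normc_triangle.
move: xy; rewrite normr_normc lecE => /andP[_ /= xy].
have h2 := le_trans (normr_Re_le _) ye; rewrite reD reN ler_norml in h2.
case/andP: h2; lra.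
Qed.

End ComplexNumbers.

(** * Integration of complex functions over the circle *)

Section IntegralsOverACircle.
Import ComplexField.Normc.
Import numFieldNormedType.Exports.
Local Open Scope complex_scope.
Local Open Scope classical_set_scope.
Context {R : realType}.
Implicit Types (f g h : R -> R[i]) (u v : R -> R) (c : R[i]) (a : R).

Local Notation mu := (@lebesgue_measure R).
Local Notation D := (@circle R).

Definition rintegrable u : Prop := mu.-integrable D (EFin \o u).

Definition cmeasurable f : Prop :=
  measurable_fun D (fun t => complex.Re (f t)) /\
  measurable_fun D (fun t => complex.Im (f t)).

Definition integrable_pow (k : nat) f : Prop :=
  cmeasurable f /\ rintegrable (fun t => normc (f t) ^+ k).

Definition L1 := integrable_pow 1.
Definition L2 := integrable_pow 2.

Definition sqrL2norm f : R := \int[mu]_(t in D) normc (f t) ^+ 2.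

Lemma measurable_circle : measurable D.
Proof. exact: measurable_itv. Qed.
#[local] Hint Resolve measurable_circle : core.

Lemma circle_measure : mu D = (2 * pi)%:E.
Proof.
rewrite /circle lebesgue_measure_itv /= lte_fin.
have pi0 := @pi_gt0 R; rewrite ifT; last by lra.
by rewrite -EFinB; congr (_%:E); ring.
Qed.

Lemma rintegrable_le u v : measurable_fun D u -> rintegrable v ->
  (forall t, D t -> `|u t| <= v t) -> rintegrable u.
Proof.
move=> mu_ iv uv; apply: le_integrable iv => //; first exact/measurable_EFinP.
by move=> t Dt; rewrite /= lee_fin (le_trans (uv _ Dt)) // ler_norm.
Qed.

Lemma rintegrableD u v : rintegrable u -> rintegrable v -> rintegrable (fun t => u t + v t).
Proof. by move=> iu iv; apply: eq_integrable (integrableD _ iu iv). Qed.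

Lemma rintegrableZ a u : rintegrable u -> rintegrable (fun t => a * u t).
Proof. by move=> iu; apply: eq_integrable (integrableZl _ a iu). Qed.

Lemma rintegrable_cst a : rintegrable (fun=> a).
Proof.
apply: measurable_bounded_integrable => //.
  by have := ltry (2 * pi : R); rewrite -circle_measure.
by exists `|a|; split; [exact: num_real|move=> x xa t _; exact: ltW].
Qed.

Lemma measurable_sin_cos_comp u : measurable_fun D u ->
  measurable_fun D (fun t => cos (u t)) /\ measurable_fun D (fun t => sin (u t)).
Proof.
move=> mu_; split; apply: measurableT_comp mu_ => //; apply: continuous_measurable_fun.
  exact: continuous_cos.
exact: continuous_sin.
Qed.

Lemma cmeasurable_cst c : cmeasurable (fun=> c).
Proof. by split. Qed.

Lemma cmeasurable_cexpi u : measurable_fun D u -> cmeasurable (fun t => cexpi (u t)).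
Proof. exact: measurable_sin_cos_comp. Qed.

Lemma cmeasurableD f g : cmeasurable f -> cmeasurable g -> cmeasurable (fun t => f t + g t).
Proof.
move=> [f1 f2] [g1 g2]; split.
  by under eq_fun do rewrite reD; exact: measurable_funD.
by under eq_fun do rewrite imD; exact: measurable_funD.
Qed.

Lemma cmeasurableM f g : cmeasurable f -> cmeasurable g -> cmeasurable (fun t => f t * g t).
Proof.
move=> [f1 f2] [g1 g2]; split.
  by under eq_fun do rewrite reM; apply: measurable_funB; exact: measurable_funM.
by under eq_fun do rewrite imM; apply: measurable_funD; exact: measurable_funM.
Qed.

Lemma cmeasurableJ f : cmeasurable f -> cmeasurable (fun t => (f t)^*%C).
Proof.
move=> [f1 f2]; split; first by under eq_fun do rewrite reJ.
by under eq_fun do rewrite imJ; exact: measurable_funN.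
Qed.

Lemma cmeasurableX f n : cmeasurable f -> cmeasurable (fun t => f t ^+ n).
Proof.
move=> mf; elim: n => [|n IH]; first exact: cmeasurable_cst.
by under eq_fun do rewrite exprS; exact: cmeasurableM.
Qed.

Lemma cmeasurable_real u : measurable_fun D u -> cmeasurable (fun t => (u t)%:C).
Proof. by move=> mu_; split. Qed.

Lemma cmeasurable_normc f : cmeasurable f -> measurable_fun D (fun t => normc (f t)).
Proof.
move=> [f1 f2].
under eq_fun do rewrite -[normc _]ger0_norm ?normc_ge0// -sqrtr_sqr normc_sqr.
have ms : measurable_fun setT (@Num.sqrt R).
  by apply: continuous_measurable_fun; exact: sqrt_continuous.
apply: (measurableT_comp ms).
by apply: measurable_funD; exact: measurable_funX.
Qed.

Lemma integrable_pow_le k f v : cmeasurable f -> rintegrable v ->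
  (forall t, D t -> normc (f t) ^+ k <= v t) -> integrable_pow k f.
Proof.
move=> mf iv fv; split=> //; apply: rintegrable_le iv _ => [|t Dt].
  by apply: measurable_funX; exact: cmeasurable_normc.
by rewrite ger0_norm ?exprn_ge0 ?normc_ge0 ?fv.
Qed.

Lemma L1_le f v : cmeasurable f -> rintegrable v ->
  (forall t, D t -> normc (f t) <= v t) -> L1 f.
Proof. by move=> mf iv fv; apply: integrable_pow_le iv _ => // t Dt; rewrite expr1 fv. Qed.

Lemma L1_normc f : L1 f -> rintegrable (fun t => normc (f t)).
Proof. by case=> _. Qed.

Lemma L1_Re f : L1 f -> rintegrable (fun t => complex.Re (f t)).
Proof. by case=> -[mf _] iff; apply: rintegrable_le iff _ => // t _; exact: normr_Re_le. Qed.

Lemma L1_Im f : L1 f -> rintegrable (fun t => complex.Im (f t)).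
Proof. by case=> -[_ mf] iff; apply: rintegrable_le iff _ => // t _; exact: normr_Im_le. Qed.

Lemma L1Z c f : L1 f -> L1 (fun t => c * f t).
Proof.
move=> [mf if_]; apply: L1_le (rintegrableZ (normc c) _ if_) _.
  by apply: cmeasurableM => //; exact: cmeasurable_cst.
by move=> t _; rewrite normcM.
Qed.

Lemma L2D f g : L2 f -> L2 g -> L2 (fun t => f t + g t).
Proof.
move=> [mf if_] [mg ig].
apply: integrable_pow_le (rintegrableD _ _ (rintegrableZ 2 _ if_) (rintegrableZ 2 _ ig)) _.
  exact: cmeasurableD.
by move=> t _; exact: normc_sqrD_le.
Qed.

Lemma L2J f : L2 f -> L2 (fun t => (f t)^*%C).
Proof.
by move=> [mf if_]; apply: integrable_pow_le if_ _ => [|t _];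
  [exact: cmeasurableJ|rewrite normc_conj].
Qed.

Lemma L2_bounded f (M : R) : cmeasurable f -> (forall t, D t -> normc (f t) <= M) -> L2 f.
Proof.
move=> mf fM; apply: integrable_pow_le (rintegrable_cst (M ^+ 2)) _ => // t Dt.
by have := normc_ge0 (f t); have := fM _ Dt; nra.
Qed.

Lemma L2_cst c : L2 (fun=> c).
Proof. exact: (L2_bounded _ (normc c) (cmeasurable_cst c)). Qed.

Lemma L2_boundedM f g (M : R) : cmeasurable f -> (forall t, D t -> normc (f t) <= M) ->
  L2 g -> L2 (fun t => f t * g t).
Proof.
move=> mf fM [mg ig]; apply: integrable_pow_le (rintegrableZ (M ^+ 2) _ ig) _ => [|t Dt].
  exact: cmeasurableM.
rewrite normcM exprMn ler_wpM2r ?sqr_ge0//.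
by have := normc_ge0 (f t); have := fM _ Dt; nra.
Qed.

Lemma L2Z c f : L2 f -> L2 (fun t => c * f t).
Proof. exact: (@L2_boundedM _ _ (normc c) (cmeasurable_cst c)). Qed.

Lemma L2B f g : L2 f -> L2 g -> L2 (fun t => f t - g t).
Proof.
move=> f2 g2; have := L2D _ _ f2 (L2Z (-1) _ g2).
by congr L2; apply/funext => t; rewrite mulN1r.
Qed.

Lemma L2M_L1 f g : L2 f -> L2 g -> L1 (fun t => f t * g t).
Proof.
move=> [mf if_] [mg ig]; apply: L1_le (rintegrableD _ _ if_ ig) _ => [|t _].
  exact: cmeasurableM.
rewrite normcM; have := normc_ge0 (f t); have := normc_ge0 (g t); nra.
Qed.

Lemma L2_L1 f : L2 f -> L1 f.
Proof.
move=> f2; have := L2M_L1 _ _ (L2_cst 1) f2.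
by congr L1; apply/funext => t; rewrite mul1r.
Qed.

Local Notation I := (cintegral D).

Lemma cintegralD f g : L1 f -> L1 g -> I (fun t => f t + g t) = I f + I g.
Proof.
move=> f1 g1; apply: complexP; rewrite ?reD ?imD /=.
  rewrite -RintegralD //; [|exact: L1_Re..].
  by apply: eq_Rintegral => t _; rewrite reD.
rewrite -RintegralD //; [|exact: L1_Im..].
by apply: eq_Rintegral => t _; rewrite imD.
Qed.

Lemma cintegralZ c f : L1 f -> I (fun t => c * f t) = c * I f.
Proof.
move=> f1; have iR := L1_Re _ f1; have iI := L1_Im _ f1.
apply: complexP; rewrite ?reM ?imM /=.
  rewrite -!RintegralZl // -RintegralB //; [|exact: rintegrableZ..].
  by apply: eq_Rintegral => t _; rewrite reM.
rewrite -!RintegralZl // -RintegralD //; [|exact: rintegrableZ..].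
by apply: eq_Rintegral => t _; rewrite imM.
Qed.

Lemma cintegralJ f : L1 f -> I (fun t => (f t)^*%C) = (I f)^*%C.
Proof.
move=> f1; apply: complexP; rewrite ?reJ ?imJ /=.
  by apply: eq_Rintegral => t _; rewrite reJ.
rewrite -mulN1r -RintegralZl //; last exact: L1_Im.
by apply: eq_Rintegral => t _; rewrite imJ mulN1r.
Qed.

Lemma cintegral_real u : I (fun t => (u t)%:C) = (\int[mu]_(t in D) u t)%:C.
Proof. by congr Complex; rewrite /= Rintegral_cst // mul0r. Qed.

(** Multiplying the integral by its own conjugate turns the triangle inequality
    into a bound for the real part. *)
Lemma normc_cintegral_le f : L1 f -> normc (I f) <= \int[mu]_(t in D) normc (f t).
Proof.
move=> f1; set z := I f; have [->|z0] := eqVneq z 0.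
  by rewrite normc0; apply: Rintegral_ge0 => t _; exact: normc_ge0.
have nz : 0 < normc z.
  rewrite lt0r normc_ge0 andbT; apply: contra z0 => /eqP /eq0_normc ->.
  exact: eqxx.
rewrite -(ler_pM2l nz) -expr2.
have -> : normc z ^+ 2 = complex.Re (I (fun t => z^*%C * f t)).
  by rewrite cintegralZ // mulrC mulcJ_normc.
rewrite -(normc_conj z); move: (z^*%C) => w.
rewrite -RintegralZl //=; last exact: L1_normc.
apply: le_Rintegral => //.
- exact: L1_Re (L1Z _ _ f1).
- exact: rintegrableZ (L1_normc _ f1).
move=> t _; apply: le_trans (ler_norm _) _; apply: le_trans (normr_Re_le _) _.
by rewrite normcM.
Qed.

Lemma sqrL2norm_ge0 f : 0 <= sqrL2norm f.
Proof. by apply: Rintegral_ge0 => t _; exact: sqr_ge0. Qed.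

Lemma sqrL2normD_le f g : L2 f -> L2 g ->
  sqrL2norm (fun t => f t + g t) <= 2 * sqrL2norm f + 2 * sqrL2norm g.
Proof.
move=> f2 g2; have [_ i1] := L2D _ _ f2 g2; case: f2 g2 => [_ if_] [_ ig].
rewrite -!RintegralZl // -RintegralD //; [|exact: rintegrableZ..].
apply: le_Rintegral => //; first by apply: rintegrableD; exact: rintegrableZ.
by move=> t _; exact: normc_sqrD_le.
Qed.

Lemma sqrL2normD f g : L2 f -> L2 g ->
  sqrL2norm (fun t => f t + g t) =
  sqrL2norm f + sqrL2norm g + 2 * complex.Re (I (fun t => f t * (g t)^*%C)).
Proof.
move=> f2 g2; have i := L1_Re _ (L2M_L1 _ _ f2 (L2J _ g2)).
case: f2 g2 => [_ if_] [_ ig].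
rewrite /sqrL2norm /= -RintegralZl // -!RintegralD //;
  [|exact: rintegrableD|exact: rintegrableZ].
by apply: eq_Rintegral => t _; rewrite normc_sqrD.
Qed.

Lemma sqrL2normZ c f : L2 f -> sqrL2norm (fun t => c * f t) = normc c ^+ 2 * sqrL2norm f.
Proof.
move=> [_ if_]; rewrite /sqrL2norm -RintegralZl //.
by apply: eq_Rintegral => t _; rewrite normcM exprMn.
Qed.

(** Cauchy-Schwarz in additive form: the weight [s] is free to be optimised. *)
Lemma normc_cintegralM_le f g (s : R) : 0 < s -> L2 f -> L2 g ->
  normc (I (fun t => f t * g t)) <= s * sqrL2norm f + s^-1 * sqrL2norm g.
Proof.
move=> s0 f2 g2; have fg := L2M_L1 _ _ f2 g2.
apply: le_trans (normc_cintegral_le _ fg) _.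
have ifg := L1_normc _ fg.
case: f2 g2 => [_ if_] [_ ig].
rewrite -!RintegralZl // -RintegralD //; [|exact: rintegrableZ..].
apply: le_Rintegral => //; first by apply: rintegrableD; exact: rintegrableZ.
move=> t _; rewrite normcM.
have -> : normc (f t) * normc (g t) = (s * normc (f t)) * (normc (g t)) / s.
  by field; rewrite gt_eqF.
have := sqr_ge0 (s * normc (f t) - normc (g t)).
have := sqr_ge0 (s * normc (f t)); have := sqr_ge0 (normc (g t)) => h1 h2 h3.
have -> : s * normc (f t) ^+ 2 + s^-1 * normc (g t) ^+ 2 =
  ((s * normc (f t)) ^+ 2 + normc (g t) ^+ 2) / s by field; rewrite gt_eqF.
rewrite ler_pM2r ?invr_gt0//; nra.
Qed.

Lemma sqrL2norm_dominated (h : nat -> R -> R[i]) (v : R -> R) :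
  (forall n, cmeasurable (h n)) -> rintegrable v ->
  (forall n t, D t -> normc (h n t) ^+ 2 <= v t) ->
  (forall t, D t -> normc (h n t) ^+ 2 @[n --> \oo] --> 0) ->
  sqrL2norm (h n) @[n --> \oo] --> 0.
Proof.
move=> mh iv hv h0.
have [] := @dominated_convergence _ _ _ mu D measurable_circle
  (fun n t => (normc (h n t) ^+ 2)%:E) (cst 0%E) (EFin \o v).
- move=> n; apply/measurable_EFinP; apply: measurable_funX.
  exact: cmeasurable_normc.
- exact: measurable_cst.
- apply: aeW => t Dt; apply/cvg_EFin; first exact: nearW.
  exact: h0.
- exact: iv.
- by apply: aeW => t n Dt; rewrite /= lee_fin ger0_norm ?sqr_ge0// hv.
move=> _ _; rewrite integral0 => H.
exact: (@fine_cvg _ _ _ _ _ _ H).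
Qed.

End IntegralsOverACircle.

(** * Trigonometric polynomials *)

Section Trigonometric.
Import ComplexField.Normc.
Import numFieldNormedType.Exports.
Local Open Scope complex_scope.
Local Open Scope classical_set_scope.
Context {R : realType}.
Implicit Types (f g h P Q : R -> R[i]) (u v : R -> R) (c : R[i]) (a : R).

Local Notation mu := (@lebesgue_measure R).
Local Notation D := (@circle R).
Local Notation I := (cintegral D).

Definition wave (n : int) (t : R) : R[i] := cexpi (n%:~R * t).

Lemma wave0 t : wave 0 t = 1.
Proof. by rewrite /wave /cexpi mul0r cos0 sin0. Qed.

Lemma waveD n m t : wave (n + m) t = wave n t * wave m t.
Proof.
rewrite /wave /cexpi intrD mulrDl cosD sinD; apply: complexP => //=.
by rewrite addrC.
Qed.

Lemma waveJ n t : (wave n t)^*%C = wave (- n) t.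
Proof. by rewrite /wave /cexpi intrN mulNr cosN sinN. Qed.

Lemma normc_wave n t : normc (wave n t) = 1.
Proof. by rewrite /wave /cexpi /= cos2Dsin2 sqrtr1. Qed.

Lemma cmeasurable_wave n : cmeasurable (wave n).
Proof. by apply: cmeasurable_cexpi; apply: measurable_funM. Qed.

(** An inductive predicate rather than a sum with coefficients: products and
    orthogonality relations can then be proved one monomial at a time, without
    reindexing double sums. *)
Inductive trig (N : nat) : (R -> R[i]) -> Prop :=
| trig0 : trig N (fun=> 0)
| trigS c n P : (`|n| <= N)%N -> trig N P -> trig N (fun t => c * wave n t + P t).

Lemma trig_monomial N c n : (`|n| <= N)%N -> trig N (fun t => c * wave n t).
Proof.
move=> nN; have := trigS N c n _ nN (trig0 N).
by congr trig; apply/funext => t; rewrite addr0.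
Qed.

Lemma trig_mono N M P : (N <= M)%N -> trig N P -> trig M P.
Proof.
move=> NM; elim=> [|c n Q nN _ IH]; first exact: trig0.
by apply: trigS => //; exact: leq_trans NM.
Qed.

Lemma trigD N P Q : trig N P -> trig N Q -> trig N (fun t => P t + Q t).
Proof.
move=> tP tQ; elim: tP => [|c n P' nN _ IH].
  by move: tQ; congr trig; apply/funext => t; rewrite add0r.
have := trigS N c n _ nN IH.
by congr trig; apply/funext => t; rewrite addrA.
Qed.

Lemma trigM N M P Q : trig N P -> trig M Q -> trig (N + M) (fun t => P t * Q t).
Proof.
move=> tP tQ; elim: tP => [|c n P' nN _ IH].
  by have := trig0 (N + M); congr trig; apply/funext => t; rewrite mul0r.
suff H : trig (N + M) (fun t => (c * wave n t) * Q t).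
  by have := trigD _ _ _ H IH; congr trig; apply/funext => t; rewrite mulrDl.
elim: tQ => [|d m Q' mM _ IH'].
  by have := trig0 (N + M); congr trig; apply/funext => t; rewrite mulr0.
have nm : (`|(n + m)%R| <= N + M)%N.
  by apply: leq_trans (leq_add nN mM); lia.
have := trigS (N + M) (c * d) (n + m) _ nm IH'.
by congr trig; apply/funext => t; rewrite waveD; ring.
Qed.

Lemma trig_bounded N P : trig N P ->
  cmeasurable P /\ exists B : R, forall t, normc (P t) <= B.
Proof.
elim=> [|c n Q _ _ [mQ [B QB]]].
  by split; [exact: cmeasurable_cst|exists 0 => t; rewrite normc0].
split.
  apply: cmeasurableD => //; apply: cmeasurableM; last exact: cmeasurable_wave.
  exact: cmeasurable_cst.
exists (normc c + B) => t; apply: le_trans (normc_triangle _ _) _.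
by rewrite normcM normc_wave mulr1 lerD2l.
Qed.

Lemma trig_L2 N P : trig N P -> L2 P.
Proof. by move=> /trig_bounded[mP [B PB]]; exact: (@L2_bounded _ _ B). Qed.

Definition trigpoly P : Prop := exists N, trig N P.

Lemma trigpoly_cst c : trigpoly (fun=> c).
Proof.
exists 0%N; have := @trig_monomial 0 c 0 (leqnn _).
by congr trig; apply/funext => t; rewrite wave0 mulr1.
Qed.

Lemma trigpolyD P Q : trigpoly P -> trigpoly Q -> trigpoly (fun t => P t + Q t).
Proof.
move=> [N tP] [M tQ]; exists (maxn N M).
by apply: trigD; [apply: trig_mono tP|apply: trig_mono tQ];
  rewrite ?leq_maxl ?leq_maxr.
Qed.

Lemma trigpolyM P Q : trigpoly P -> trigpoly Q -> trigpoly (fun t => P t * Q t).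
Proof. by move=> [N tP] [M tQ]; exists (N + M)%N; exact: trigM. Qed.

Lemma trigpolyZ c P : trigpoly P -> trigpoly (fun t => c * P t).
Proof. by move=> tP; apply: trigpolyM => //; exact: trigpoly_cst. Qed.

Lemma trigpolyX P n : trigpoly P -> trigpoly (fun t => P t ^+ n).
Proof.
move=> tP; elim: n => [|n IH]; first exact: trigpoly_cst.
by have := trigpolyM _ _ tP IH; congr trigpoly; apply/funext => t; rewrite exprS.
Qed.

Lemma trigpolyB P Q : trigpoly P -> trigpoly Q -> trigpoly (fun t => P t - Q t).
Proof.
move=> tP tQ; have := trigpolyD _ _ tP (trigpolyZ (-1) _ tQ).
by congr trigpoly; apply/funext => t; rewrite mulN1r.
Qed.

Lemma trigpoly_L2 P : trigpoly P -> L2 P.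
Proof. by case=> N; exact: trig_L2. Qed.

Lemma trigpoly_cos a : trigpoly (fun t => (cos (a - t))%:C).
Proof.
have m n : (`|n| <= 1)%N -> trigpoly (fun t => (2^-1)%:C * cexpi (- n%:~R * a) * wave n t).
  by move=> n1; exists 1%N; exact: trig_monomial.
have := trigpolyD _ _ (m 1 isT) (m (-1) isT).
congr trigpoly; apply/funext => t.
rewrite /wave /cexpi !mulrNz !mulN1r opprK !mul1r !cosN !sinN cosB.
by apply: complexP => /=; field.
Qed.

End Trigonometric.

(** * Density of trigonometric polynomials in L2 *)

Section StepPolynomials.
Context {R : realType}.
Implicit Types (x y r : R).

Lemma bernoulli_le1 y n : 0 <= y <= 1 -> 1 - n%:R * y <= (1 - y) ^+ n.
Proof.
move=> y01; elim: n => [|n IH]; first by rewrite mul0r subr0 expr0.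
rewrite exprS; apply: (@le_trans _ _ ((1 - y) * (1 - n%:R * y))); last first.
  by rewrite ler_wpM2l //; lra.
have n0 : 0 <= n%:R :> R by exact: ler0n.
rewrite -natr1; nra.
Qed.

Lemma bernoulli_ge0 y n : 0 <= y -> 1 + n%:R * y <= (1 + y) ^+ n.
Proof.
move=> y0; elim: n => [|n IH]; first by rewrite mul0r addr0 expr0.
rewrite exprS; apply: (@le_trans _ _ ((1 + y) * (1 + n%:R * y))); last first.
  by rewrite ler_wpM2l //; lra.
have n0 : 0 <= n%:R :> R by exact: ler0n.
rewrite -natr1; nra.
Qed.

(** [(1 - r) * n * r ^ n] is at most the telescoping sum of the [(1 - r) * r ^ k]
    over [k < n], since [r ^ n] is the smallest of these powers. *)
Lemma natr_expr_le r n : 0 <= r < 1 -> n%:R * r ^+ n <= (1 - r)^-1.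
Proof.
move=> /andP[r0 r1]; have r1' : 0 < 1 - r by lra.
rewrite -[leRHS]mul1r ler_pdivlMr //.
suff : n%:R * r ^+ n * (1 - r) <= 1 - r ^+ n by have := exprn_ge0 n r0; lra.
elim: n => [|n IH]; first by rewrite !mul0r expr0 subrr.
rewrite -natr1 exprS.
have rn1 : r * r ^+ n <= 1 by rewrite -exprS exprn_ile1 // ltW.
have := exprn_ge0 n r0; move: (r ^+ n) IH rn1 => z IH rn1 z0; nra.
Qed.

(** On [0, 1] the graph of this polynomial falls from 1 to 0 around the
    threshold 1/2 within a window that shrinks as n grows, since
    x ^ (2 n) is compared with the inverse of 4 ^ n; the extra
    exponent n makes the limit at the threshold itself equal to 0. *)
Definition step_poly (n : nat) (x : R) : R := (1 - x ^+ (2 * n)) ^+ (4 ^ n * n).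

Lemma step_poly01 n x : 0 <= x <= 1 -> 0 <= step_poly n x <= 1.
Proof.
move=> /andP[x0 x1]; have h0 : 0 <= x ^+ (2 * n) by exact: exprn_ge0.
have h1 : x ^+ (2 * n) <= 1 by exact: exprn_ile1.
by rewrite /step_poly exprn_ge0 ?exprn_ile1 //; lra.
Qed.

(** Bernoulli: the loss is at most [4 ^ n * n] times [x ^ (2 * n)], that is
    [n * (2 * x) ^ n] times [(2 * x) ^ n], and the first of these is bounded. *)
Lemma step_poly_lt n x : 0 <= x < 2^-1 ->
  1 - step_poly n x <= (1 - 2 * x)^-1 * (2 * x) ^+ n.
Proof.
move=> /andP[x0 x1].
have h0 : 0 <= x ^+ (2 * n) by exact: exprn_ge0.
have h1 : x ^+ (2 * n) <= 1 by apply: exprn_ile1 => //; lra.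
have := @bernoulli_le1 (x ^+ (2 * n)) (4 ^ n * n).
rewrite h0 h1 => /(_ isT) h.
apply: le_trans (_ : n%:R * (2 * x) ^+ n * (2 * x) ^+ n <= _); last first.
  rewrite ler_wpM2r ?exprn_ge0 //; first by lra.
  by apply: natr_expr_le; apply/andP; split; lra.
have -> : n%:R * (2 * x) ^+ n * (2 * x) ^+ n = (4 ^ n * n)%:R * x ^+ (2 * n).
  rewrite natrM natrX exprM -mulrA -exprMn.
  have -> : 2 * x * (2 * x) = 4%:R * x ^+ 2 by ring.
  by rewrite exprMn; ring.
by move: h; rewrite /step_poly; lra.
Qed.

(** With [y = x ^ (2 * n)], Bernoulli gives [(1 + y) ^ (4 ^ n) >= 2] as soon as
    [4 ^ n * y >= 1], while [(1 - y) * (1 + y) <= 1]; so [(1 - y) ^ (4 ^ n)] is at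
    most one half. *)
Lemma step_poly_ge n x : 2^-1 <= x <= 1 -> step_poly n x <= 2^-1 ^+ n.
Proof.
move=> /andP[x0 x1]; rewrite /step_poly exprM.
set y := x ^+ (2 * n).
have y0 : 0 <= y by apply: exprn_ge0; lra.
have y1 : y <= 1 by apply: exprn_ile1 => //; lra.
have y4 : 1 <= (4 ^ n)%:R * y.
  rewrite natrX /y exprM -exprMn; apply: exprn_ege1; nra.
have h0 : 0 <= (1 - y) ^+ (4 ^ n) by apply: exprn_ge0; lra.
rewrite lerXn2r ?nnegrE ?invr_ge0 //.
have h : (1 - y) ^+ (4 ^ n) * (1 + y) ^+ (4 ^ n) <= 1.
  by rewrite -exprMn; apply: exprn_ile1; nra.
have := @bernoulli_ge0 y (4 ^ n) y0; nra.
Qed.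

Lemma step_poly_cvg x : 0 <= x <= 1 -> exists C r : R, 0 <= r < 1 /\
  forall n, `|(x < 2^-1)%R%:R - step_poly n x : R| <= C * r ^+ n.
Proof.
move=> x01; case: (ltP x 2^-1) => hx.
  exists (1 - 2 * x)^-1, (2 * x); split; first by apply/andP; split; lra.
  move=> n; have /andP[_ h] := step_poly01 n _ x01.
  rewrite ger0_norm ?subr_ge0 //; apply: step_poly_lt; lra.
exists 1, 2^-1; split; first by apply/andP; split; lra.
move=> n; have /andP[h _] := step_poly01 n _ x01.
rewrite mul1r sub0r normrN ger0_norm //; apply: step_poly_ge; lra.
Qed.

End StepPolynomials.

Section Density.
Import ComplexField.Normc.
Import HBSimple HBNNSimple.
Import numFieldNormedType.Exports.
Local Open Scope complex_scope.
Local Open Scope classical_set_scope.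
Context {R : realType}.
Implicit Types (f g h P Q : R -> R[i]) (u v : R -> R) (c : R[i]) (a : R).

Local Notation mu := (@lebesgue_measure R).
Local Notation D := (@circle R).

Definition L2_trig_closure f : Prop :=
  L2 f /\ forall s : R, 0 < s ->
    exists P, trigpoly P /\ sqrL2norm (fun t => f t - P t) <= s.

Lemma closure_lim f : L2 f ->
  (forall s : R, 0 < s ->
    exists g, L2_trig_closure g /\ sqrL2norm (fun t => f t - g t) <= s) ->
  L2_trig_closure f.
Proof.
move=> f2 fg; split=> // s s0.
have s4 : 0 < s / 4 by lra.
have [g [[g2 gP] fgs]] := fg _ s4; have [P [tP gPs]] := gP _ s4.
exists P; split=> //.
have := sqrL2normD_le _ _ (L2B _ _ f2 g2) (L2B _ _ g2 (trigpoly_L2 _ tP)).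
have -> : (fun t => f t - g t + (g t - P t)) = (fun t => f t - P t).
  by apply/funext => t; rewrite addrA subrK.
lra.
Qed.

Lemma closure_trig P : trigpoly P -> L2_trig_closure P.
Proof.
move=> tP; split=> [|s s0]; first exact: trigpoly_L2.
exists P; split=> //; rewrite /sqrL2norm (@eq_Rintegral _ _ _ _ _ (fun=> 0)).
  by rewrite Rintegral_cst ?mul0r; [exact: ltW|exact: measurable_circle].
by move=> t _; rewrite subrr normc0 expr0n.
Qed.

Lemma closureD f g : L2_trig_closure f -> L2_trig_closure g ->
  L2_trig_closure (fun t => f t + g t).
Proof.
move=> [f2 fP] [g2 gP]; split=> [|s s0]; first exact: L2D.
have s4 : 0 < s / 4 by lra.
have [P [tP fs]] := fP _ s4; have [Q [tQ gs]] := gP _ s4.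
exists (fun t => P t + Q t); split; first exact: trigpolyD.
have := sqrL2normD_le _ _ (L2B _ _ f2 (trigpoly_L2 _ tP)) (L2B _ _ g2 (trigpoly_L2 _ tQ)).
have -> : (fun t => f t - P t + (g t - Q t)) = (fun t => f t + g t - (P t + Q t)).
  by apply/funext => t; ring.
lra.
Qed.

Lemma closureZ c f : L2_trig_closure f -> L2_trig_closure (fun t => c * f t).
Proof.
move=> [f2 fP]; split=> [|s s0]; first exact: L2Z.
have k0 : 0 < normc c ^+ 2 + 1 by have := sqr_ge0 (normc c); lra.
have [P [tP fs]] := fP _ (divr_gt0 s0 k0).
exists (fun t => c * P t); split; first exact: trigpolyZ.
have -> : (fun t => c * f t - c * P t) = (fun t => c * (f t - P t)).
  by apply/funext => t; ring.
rewrite sqrL2normZ; last exact: L2B f2 (trigpoly_L2 _ tP).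
move: fs; rewrite ler_pdivlMr //; have := sqrL2norm_ge0 (fun t => f t - P t); lra.
Qed.

Lemma closureB f g : L2_trig_closure f -> L2_trig_closure g ->
  L2_trig_closure (fun t => f t - g t).
Proof.
move=> cf cg; have := closureD _ _ cf (closureZ (-1) _ cg).
by congr L2_trig_closure; apply/funext => t; rewrite mulN1r.
Qed.

Lemma closure_sum (J : Type) (s : seq J) (F : J -> R -> R[i]) :
  (forall i, L2_trig_closure (F i)) ->
  L2_trig_closure (fun t => \sum_(i <- s) F i t).
Proof.
move=> cF; elim: s => [|i s IH].
  have := closure_trig _ (trigpoly_cst 0).
  by congr L2_trig_closure; apply/funext => t; rewrite big_nil.
have := closureD _ _ (cF i) IH.
by congr L2_trig_closure; apply/funext => t; rewrite big_cons.
Qed.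

Lemma closure_dominated f (g : nat -> R -> R[i]) v : L2 f ->
  (forall n, L2_trig_closure (g n)) -> rintegrable v ->
  (forall n t, D t -> normc (f t - g n t) ^+ 2 <= v t) ->
  (forall t, D t -> normc (f t - g n t) ^+ 2 @[n --> \oo] --> 0) ->
  L2_trig_closure f.
Proof.
move=> f2 cg iv fgv fg0; apply: closure_lim => // s s0.
have mfg n : cmeasurable (fun t => f t - g n t) by case: (L2B _ _ f2 (cg n).1).
have /cvgr0Pnorm_le/(_ _ s0)[n _ H] := sqrL2norm_dominated _ _ mfg iv fgv fg0.
exists (g n); split=> //; apply: le_trans (H n (leqnn _)).
exact: ler_norm.
Qed.

Lemma normc_realB_sqr_cvg0 (w : R) (z : nat -> R) (C r : R) : 0 <= r < 1 ->
  (forall n, `|w - z n| <= 1) -> (forall n, `|w - z n| <= C * r ^+ n) ->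
  normc (w%:C - (z n)%:C) ^+ 2 @[n --> \oo] --> 0.
Proof.
move=> /andP[r0 r1] h1 hC.
have hg : C * r ^+ n @[n --> \oo] --> (0 : R).
  by apply: cvg_geometric; rewrite ger0_norm.
apply: squeeze_cvgr (cvg_cst 0) hg; apply: nearW => n.
rewrite sqr_ge0 -rmorphB normc_real; apply: le_trans (hC n).
by have := h1 n; have := normr_ge0 (w - z n); nra.
Qed.

Lemma L2_indic (A : set R) : measurable A -> L2 (fun t => (\1_A t)%:C).
Proof.
move=> mA; apply: (@L2_bounded _ _ 1) => [|t _].
  by apply: cmeasurable_real; exact: measurable_indic.
by rewrite normc_real indicE; case: (_ \in _); rewrite ?normr1 ?normr0.
Qed.

(** On the circle a ray is empty, everything, or an arc. An arc is the positivity set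
    of a trigonometric polynomial of degree one; step polynomials composed with it
    converge pointwise and boundedly to the indicator, so that dominated convergence
    applies. *)
Lemma closure_indic_ray a : L2_trig_closure (fun t => (\1_(`]a, +oo[ : set R) t)%:C).
Proof.
have pi0 := @pi_gt0 R.
have L2i := @L2_indic `]a, +oo[ (measurable_itv _).
have cstD (b : R) : (forall t, D t -> \1_(`]a, +oo[ : set R) t = b) ->
    L2_trig_closure (fun t => (\1_(`]a, +oo[ : set R) t)%:C).
  move=> H; apply: closure_lim => // s s0.
  exists (fun=> b%:C); split; first by apply: closure_trig; exact: trigpoly_cst.
  rewrite /sqrL2norm (@eq_Rintegral _ _ _ _ _ (fun=> 0)).
    by rewrite Rintegral_cst ?mul0r; [exact: ltW|exact: measurable_circle].
  by move=> t /set_mem Dt; rewrite H // subrr normc0 expr0n.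
case: (ltP a (- pi)) => [api|api].
  apply: (cstD 1) => t; rewrite /circle /= in_itv /= indicE => /andP[t1 t2].
  by rewrite mem_set //= in_itv /= andbT; lra.
case: (leP pi a) => [pia|pia].
  apply: (cstD 0) => t; rewrite /circle /= in_itv /= indicE => /andP[t1 t2].
  by rewrite memNset //= in_itv /= andbT; lra.
(* v is positive exactly on the arc; the affine change to u turns this into
   the threshold 1/2 and puts all values in [0, 1]. *)
pose v t : R := sin ((pi - t) / 2) * sin ((t - a) / 2).
pose u t : R := 2^-1 - v t / 2.
have vE t : v t = (cos ((pi + a) / 2 - t) - cos ((pi - a) / 2)) / 2.
  have -> : (pi + a) / 2 - t = (pi - t) / 2 - (t - a) / 2 by field.
  have -> : (pi - a) / 2 = (pi - t) / 2 + (t - a) / 2 by field.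
  by rewrite cosB cosD /v; field.
have tu : trigpoly (fun t => (u t)%:C).
  have := trigpolyB _ _ (trigpoly_cst (2^-1)%:C) (trigpolyZ (2^-1)%:C _
    (trigpolyZ (2^-1)%:C _ (trigpolyB _ _ (trigpoly_cos ((pi + a) / 2))
     (trigpoly_cst (cos ((pi - a) / 2))%:C)))).
  congr trigpoly; apply/funext => t; rewrite -!rmorphB -!rmorphM -rmorphB /=.
  by congr (_%:C); rewrite /u vE; ring.
have u01 t : 0 <= u t <= 1.
  have : `|v t| <= 1 by rewrite /v normrM mulr_ile1 ?sin_max.
  by rewrite ler_norml /u => /andP[h1 h2]; apply/andP; split; lra.
have uA t : D t -> \1_(`]a, +oo[ : set R) t = (u t < 2^-1)%R%:R.
  rewrite /circle /= in_itv /= indicE => /andP[t1 t2].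
  have -> : (u t < 2^-1) = (0 < v t) by apply/idP/idP; rewrite /u; lra.
  have s1 : t != - pi -> 0 < sin ((pi - t) / 2).
    move=> tpi; apply: sin_gt0_pi.
    have : - pi < t by rewrite lt_neqAle eq_sym tpi.
    by move=> h; apply/andP; split; lra.
  case: (ltP a t) => at_.
    rewrite mem_set /=; last by rewrite in_itv /= at_.
    have tpi : t != - pi by rewrite gt_eqF //; lra.
    have s2 : 0 < sin ((t - a) / 2) by apply: sin_gt0_pi; apply/andP; split; lra.
    by rewrite /v mulr_gt0 // s1.
  rewrite memNset /=; last by rewrite in_itv /= andbT; lra.
  rewrite ltNge /v; have [->|/s1 s1'] := eqVneq t (- pi).
    have -> : (pi - - pi) / 2 = pi :> R by field.
    by rewrite sinpi mul0r lexx.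
  rewrite pmulr_rle0 //.
  have -> : sin ((t - a) / 2) = - sin ((a - t) / 2).
    by rewrite -sinN; congr sin; ring.
  rewrite oppr_le0 sin_ge0_pi //; apply/andP; split; lra.
have i01 t : 0 <= (\1_(`]a, +oo[ : set R) t : R) <= 1.
  by rewrite indicE; case: (_ \in _); rewrite lexx ler01.
have ind_step n t : `|\1_(`]a, +oo[ : set R) t - step_poly n (u t)| <= 1.
  have := i01 t; have := step_poly01 n _ (u01 t).
  by rewrite ler_norml => /andP[? ?] /andP[? ?]; apply/andP; split; lra.
apply: (@closure_dominated _ (fun n t => (step_poly n (u t))%:C) (fun=> 1)) => //.
- move=> n; apply: closure_trig.
  have := trigpolyX _ (4 ^ n * n) (trigpolyB _ _ (trigpoly_cst 1) (trigpolyX _ (2 * n) tu)).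
  congr trigpoly; apply/funext => t.
  by rewrite -(rmorph1 (real_complex R)) -!rmorphXn -rmorphB -rmorphXn.
- exact: rintegrable_cst.
- move=> n t Dt; rewrite -rmorphB normc_real.
  have := normr_ge0 (\1_(`]a, +oo[ : set R) t - step_poly n (u t)).
  by have := ind_step n t; nra.
move=> t Dt; have [C [r [r01 H]]] := step_poly_cvg _ (u01 t).
apply: (@normc_realB_sqr_cvg0 _ _ C r) => // n.
by rewrite uA.
Qed.

(** Rays form a pi-system that generates the Borel sets, and the sets whose
    indicators lie in the closure form a Dynkin system. *)
Lemma closure_indic (A : set R) : measurable A -> L2_trig_closure (fun t => (\1_A t)%:C).
Proof.
move: A; pose P (A : set R) := L2_trig_closure (fun t => (\1_A t)%:C).
have mE : @measurable _ (measurableTypeR R) = <<s @RGenOInfty.G R >>.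
  exact: RGenOInfty.measurableE.
have indC (A : set R) t : (\1_(~` A) t : R) = 1 - \1_A t.
  by rewrite !indicE in_setC; case: (_ \in _); rewrite ?subrr ?subr0.
suff H : forall A : set R, <<s @RGenOInfty.G R >> A -> P A.
  by move=> A mA; apply: H; rewrite -mE.
apply: (@dynkin_induction _ (measurableTypeR R) _ P mE).
- move=> _ _ [x ->] [y ->]; exists (Num.max x y).
  rewrite predeqE => t /=; rewrite !in_itv /= !andbT gt_max.
  by split=> [[-> ->]//|/andP[]].
- rewrite /P; have := closure_trig _ (trigpoly_cst 1).
  by congr L2_trig_closure; apply/funext => t; rewrite indicT.
- by move=> _ [x ->]; exact: closure_indic_ray.
- move=> A _ cA; have := closureB _ _ (closure_trig _ (trigpoly_cst 1)) cA.
  by congr L2_trig_closure; apply/funext => t; rewrite indC rmorphB.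
move=> F mF tF cF; rewrite /P.
(* By disjointness, the partial sum of the indicators at t jumps from 0 to 1
   right after the index of the only set that contains t. *)
have sumE n t : \sum_(i < n) (\1_(F i) t : R) =
    if pselect (exists k, F k t) is left ex then (projT1 (cid ex) < n)%N%:R else 0.
  case: pselect => [ex|nex]; last first.
    by rewrite big1 // => i _; rewrite indicE memNset // => Fi; apply: nex; exists i.
  case: (cid ex) => k /= Fk.
  have Fi (i : nat) : (\1_(F i) t : R) = (i == k)%:R.
    rewrite indicE; have [->|ik] := eqVneq i k; first by rewrite mem_set.
    rewrite memNset // => Fi; move/eqP: ik; apply.
    by apply: (tF i k) => //; exists t.
  under eq_bigr do rewrite Fi.
  case: (ltnP k n) => kn.
    rewrite (bigD1 (Ordinal kn)) //= eqxx big1 ?addr0 // => i ik.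
    by rewrite -(inj_eq val_inj) /= in ik; rewrite (negbTE ik).
  rewrite big1 // => i _; rewrite ltn_eqF //.
  exact: leq_trans kn.
have UE t : (\1_(\bigcup_k F k) t : R) = if pselect (exists k, F k t) then 1 else 0.
  rewrite indicE; case: pselect => [[k Fk]|nex].
    by rewrite mem_set //; exists k.
  by rewrite memNset // => -[k _ Fk]; apply: nex; exists k.
apply: (@closure_dominated _ (fun n t => \sum_(i < n) (\1_(F i) t)%:C) (fun=> 1)).
- by apply: L2_indic; exact: bigcupT_measurable.
- move=> n; apply: (closure_sum _ _ (fun (i : 'I_n) t => (\1_(F i) t)%:C)).
  by move=> i; exact: cF.
- exact: rintegrable_cst.
- move=> n t _; rewrite -rmorph_sum -rmorphB normc_real sumE UE.
  case: pselect => [ex|nex] /=; last by rewrite subrr normr0 expr0n.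
  by case: (_ < n)%N; rewrite ?subrr ?subr0 ?normr0 ?normr1 ?expr0n ?expr1n.
move=> t _; apply: cvg_near_cst.
case: (pselect (exists k, F k t)) => [ex|nex].
  exists (projT1 (cid ex)).+1 => // n /= kn.
  rewrite -rmorph_sum -rmorphB normc_real sumE UE.
  case: pselect => // ex'; rewrite (Prop_irrelevance ex' ex) kn subrr normr0.
  by rewrite expr0n.
apply: nearW => n; rewrite -rmorph_sum -rmorphB normc_real sumE UE.
by case: pselect => //= _; rewrite subrr normr0 expr0n.
Qed.

(** Simple functions increase to u, and u ^ 2 dominates the squared errors. *)
Lemma closure_nonneg u : L2 (fun t => (u t)%:C) -> (forall t, 0 <= u t) ->
  L2_trig_closure (fun t => (u t)%:C).
Proof.
move=> u2 u0; have [[mu1 _] iu] := u2.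
have mEu : measurable_fun D (EFin \o u) by exact/measurable_EFinP.
pose g n := nnsfun_approx measurable_circle mEu n.
have u0' t : D t -> (0%R <= (EFin \o u) t)%E by rewrite lee_fin.
have gu n t : D t -> 0 <= g n t <= u t.
  move=> Dt; apply/andP; split; first exact: fun_ge0.
  by have := le_approx n u0' Dt; rewrite lee_fin /g nnsfun_approxE.
apply: (@closure_dominated _ (fun n t => (g n t)%:C) (fun t => normc (u t)%:C ^+ 2)) => //.
- move=> n.
  have := closure_sum _ (finmap.enum_fset (fset_set (range (g n))))
    (fun y t => y%:C * (\1_(g n @^-1` [set y]) t)%:C).
  rewrite (_ : (fun t => \sum_(i <- _) _) = (fun t => (g n t)%:C)); last first.
    apply/funext => t; rewrite (fimfunE (g n) t) fsbig_finite //= rmorph_sum.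
    by apply: eq_bigr => y _; rewrite rmorphM.
  apply=> y; apply: closureZ; apply: closure_indic.
  exact: measurable_funPTI.
- move=> n t Dt; rewrite -rmorphB !normc_real !real_normK ?num_real //.
  by have := gu n t Dt; nra.
move=> t Dt.
have /fine_cvg gc := cvg_nnsfun_approx measurable_circle mEu u0' Dt.
have h0 : (u t - g n t) @[n --> \oo] --> (0 : R).
  by rewrite -(subrr (u t)); apply: cvgB; [exact: cvg_cst|exact: gc].
have h : (u t - g n t) ^+ 2 @[n --> \oo] --> (0 : R).
  rewrite -(mulr0 (0 : R)); under eq_fun do rewrite expr2; exact: cvgM.
suff -> : (fun n => normc ((u t)%:C - (g n t)%:C) ^+ 2) = (fun n => (u t - g n t) ^+ 2).
  exact: h.
by apply/funext => n; rewrite -rmorphB normc_real real_normK ?num_real.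
Qed.

(** The closure is a complex vector space, and the real and imaginary parts are
    differences of the nonnegative functions (|u| + u) / 2 and (|u| - u) / 2. *)
Lemma L2_in_closure f : L2 f -> L2_trig_closure f.
Proof.
move=> f2; have [[m1 m2] if_] := f2.
have real_case (u : R -> R) : measurable_fun D u ->
    (forall t, `|u t| <= normc (f t)) -> L2_trig_closure (fun t => (u t)%:C).
  move=> mu_ uf.
  have part (s : R) : `|s| = 1 -> L2_trig_closure (fun t => ((`|u t| + s * u t) / 2)%:C).
    move=> s1.
    have su t : `|s * u t| <= `|u t| by rewrite normrM s1 mul1r.
    apply: closure_nonneg => [|t]; last first.
      by have := su t; rewrite ler_norml => /andP[? ?]; lra.
    apply: integrable_pow_le if_ _.
      apply: cmeasurable_real; apply: measurable_funM => //; apply: measurable_funD.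
        exact: measurableT_comp.
      exact: measurable_funM.
    move=> t _; rewrite normc_real; have h := uf t.
    have := su t; rewrite ler_norml => /andP[h1 h2].
    have : `|(`|u t| + s * u t) / 2| <= normc (f t).
      by rewrite ger0_norm; lra.
    by have := normr_ge0 ((`|u t| + s * u t) / 2); nra.
  have := closureB _ _ (part 1 (normr1 _)) (part (-1) (normrN1 _)).
  congr L2_trig_closure; apply/funext => t; rewrite -rmorphB.
  by congr (_%:C); field.
have cR := real_case _ m1 (fun t => normr_Re_le (f t)).
have cI := real_case _ m2 (fun t => normr_Im_le (f t)).
have := closureD _ _ cR (closureZ 'i%C _ cI).
congr L2_trig_closure; apply/funext => t.
by rewrite [RHS]complexE.
Qed.

End Density.

(** * Fourier coefficients and majorization *)

Section FourierCoefficients.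
Import ComplexField.Normc.
Import numFieldNormedType.Exports.
Local Open Scope complex_scope.
Local Open Scope classical_set_scope.
Context {R : realType}.
Implicit Types (f g h A B P Q : R -> R[i]) (c : R[i]) (n m : int).

Local Notation mu := (@lebesgue_measure R).
Local Notation D := (@circle R).
Local Notation I := (cintegral D).

Lemma Rintegral_circle_derive (F u : R -> R) :
  (forall x : R, is_derive x (1 : R) F (u x)) -> continuous u ->
  \int[mu]_(t in D) u t = F pi - F (- pi).
Proof.
move=> dF cu; have pi0 := @pi_gt0 R.
have cF (x : R) : {for x, continuous F}.
  by apply: differentiable_continuous; apply/derivable1_diffP; case: (dF x).
have iu : mu.-integrable `[- pi, pi] (EFin \o u).
  apply: continuous_compact_integrable; first exact: segment_compact.
  exact: continuous_subspaceT.
rewrite /circle Rintegral_itv_bndo_bndc; last first.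
  by apply: integrableS iu => //; exact: subset_itv_co_cc.
rewrite /Rintegral (@continuous_FTC2 _ u F) //.
- lra.
- exact: continuous_subspaceT.
- split; first by move=> x _; case: (dF x).
    by apply: cvg_at_right_filter; exact: cF.
  by apply: cvg_at_left_filter; exact: cF.
- by move=> x _; rewrite derive1E; case: (dF x).
Qed.

Lemma sin_intmul_pi n : sin (n%:~R * pi) = 0 :> R.
Proof.
have H k : sin (k%:R * pi) = 0 :> R.
  elim: k => [|k IH]; first by rewrite mul0r sin0.
  by rewrite -natr1 mulrDl mul1r sinDpi IH oppr0.
case: n => k; first by rewrite -pmulrn H.
by rewrite NegzE mulrNz mulNr sinN -pmulrn H oppr0.
Qed.

Definition mean f : R[i] := ((2 * pi)^-1)%:C * I f.

Lemma normc_mean_le f : normc (mean f) <= normc (I f).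
Proof.
rewrite normcM normc_real ger0_norm; last by rewrite invr_ge0 mulr_ge0 ?pi_ge0.
rewrite ler_piMl ?normc_ge0 // invf_le1; last by have := @pi_gt0 R; lra.
by have := @pi_ge2 R; lra.
Qed.

Lemma meanD f g : L1 f -> L1 g -> mean (fun t => f t + g t) = mean f + mean g.
Proof. by move=> f1 g1; rewrite /mean cintegralD // mulrDr. Qed.

Lemma meanZ c f : L1 f -> mean (fun t => c * f t) = c * mean f.
Proof. by move=> f1; rewrite /mean cintegralZ // mulrCA. Qed.

Lemma mean_wave n : mean (@wave R n) = (n == 0)%:R.
Proof.
have [->|n0] := eqVneq n 0.
  have -> : wave 0 = (fun t : R => (1 : R)%:C) by apply/funext => t; rewrite wave0.
  rewrite /mean cintegral_real Rintegral_cst; last exact: measurable_circle.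
  have -> : fine (mu D) = 2 * pi by have := @circle_measure R => ->.
  rewrite -rmorphM mul1r mulVf // mulf_neq0 ?pnatr_eq0 //.
  by rewrite gt_eqF ?pi_gt0.
have nR : n%:~R != 0 :> R by rewrite intr_eq0.
have dl (x : R) : is_derive x (1 : R) ( *%R n%:~R : R -> R) n%:~R.
  have := @is_deriveZ _ _ _ id n%:~R x 1 1 (is_derive_id _ _).
  by move=> h; apply: is_derive_eq; rewrite ?scaler1.
have ds (x : R) : is_derive x (1 : R) (fun t : R => n%:~R^-1 * sin (n%:~R * t)) (cos (n%:~R * x)).
  apply: is_derive_eq.
  by rewrite /GRing.scale /=; field.
have dc (x : R) : is_derive x (1 : R) (fun t : R => - n%:~R^-1 * cos (n%:~R * t)) (sin (n%:~R * x)).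
  apply: is_derive_eq.
  by rewrite /GRing.scale /=; field.
have cm : continuous (fun t : R => n%:~R * t) by move=> x; exact: mulrl_continuous.
rewrite /mean /cintegral /wave /cexpi /=.
rewrite (Rintegral_circle_derive _ _ ds); last first.
  by move=> x; apply: continuous_comp; [exact: cm|exact: continuous_cos].
rewrite (Rintegral_circle_derive _ _ dc); last first.
  by move=> x; apply: continuous_comp; [exact: cm|exact: continuous_sin].
rewrite mulrN sinN cosN sin_intmul_pi oppr0 mulr0 !subrr.
exact: mulr0.
Qed.

Lemma fourierE f n : fourier f n = mean (fun t => f t * wave (- n) t).
Proof.
rewrite /fourier /mean; congr (_ * cintegral _ _); apply/funext => t.
by rewrite /wave intrN mulNr.
Qed.

Lemma fourier0 f : fourier f 0 = mean f.
Proof.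
by rewrite fourierE; congr mean; apply/funext => t; rewrite oppr0 wave0 mulr1.
Qed.

Lemma L1Me f n : L1 f -> L1 (fun t => f t * wave n t).
Proof.
move=> [mf if_]; apply: L1_le if_ _ => [|t _]; first exact: cmeasurableM (cmeasurable_wave n).
by rewrite normcM normc_wave mulr1.
Qed.

Lemma L2Me f n : L2 f -> L2 (fun t => f t * wave n t).
Proof.
move=> [mf if_]; apply: integrable_pow_le if_ _ => [|t _].
  exact: cmeasurableM (cmeasurable_wave n).
by rewrite normcM normc_wave mulr1.
Qed.

Lemma fourierD f g n : L1 f -> L1 g ->
  fourier (fun t => f t + g t) n = fourier f n + fourier g n.
Proof.
move=> f1 g1; rewrite !fourierE -meanD; [|exact: L1Me..].
by congr mean; apply/funext => t; rewrite mulrDl.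
Qed.

Lemma fourierZ c f n : L1 f -> fourier (fun t => c * f t) n = c * fourier f n.
Proof.
move=> f1; rewrite !fourierE -meanZ; last exact: L1Me.
by congr mean; apply/funext => t; rewrite mulrA.
Qed.

Lemma fourierB f g n : L1 f -> L1 g ->
  fourier (fun t => f t - g t) n = fourier f n - fourier g n.
Proof.
move=> f1 g1; have := fourierD _ _ n f1 (L1Z (-1) _ g1).
rewrite fourierZ // mulN1r => <-.
by congr (fourier _ n); apply/funext => t; rewrite mulN1r.
Qed.

Lemma fourierJ f n : L1 f -> fourier (fun t => (f t)^*%C) n = (fourier f (- n))^*%C.
Proof.
move=> f1; rewrite !fourierE /mean opprK conjcM conjc_real -cintegralJ; last first.
  exact: L1Me.
by congr (_ * cintegral _ _); apply/funext => t; rewrite conjcM waveJ.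
Qed.

Lemma fourierMe f n m : fourier (fun t => wave m t * f t) n = fourier f (n - m).
Proof.
rewrite !fourierE; congr mean; apply/funext => t.
by rewrite opprB waveD; ring.
Qed.

Lemma fourier_wave n m : fourier (@wave R m) n = (m == n)%:R.
Proof.
rewrite fourierE -(subr_eq0 m n) -mean_wave; congr mean.
by apply/funext => t; rewrite -waveD.
Qed.

Definition freq (N : nat) : seq int := [seq k%:Z - N%:Z | k <- iota 0 (2 * N).+1].

Lemma freq_uniq N : uniq (freq N).
Proof. by rewrite map_inj_uniq ?iota_uniq // => a b /addIr []. Qed.

Lemma mem_freq N n : (n \in freq N) = (`|n| <= N)%N.
Proof.
apply/mapP/idP => [[k]|nN]; first by rewrite mem_iota => /andP[_ kN] ->; lia.
exists (absz (n + N%:Z)); last by lia.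
by rewrite mem_iota; lia.
Qed.

Definition trigsum (s : seq int) (c : int -> R[i]) (t : R) : R[i] :=
  \sum_(m <- s) c m * wave m t.

Lemma trigsum_trig N s (c : int -> R[i]) :
  (forall m, m \in s -> (`|m| <= N)%N) -> trig N (trigsum s c).
Proof.
elim: s => [|m s IH] H.
  by have := @trig0 R N; congr trig; apply/funext => t; rewrite /trigsum big_nil.
have Hs m' : m' \in s -> (`|m'| <= N)%N by move=> ms; apply: H; rewrite inE ms orbT.
have := trigS N (c m) m _ (H m (mem_head _ _)) (IH Hs).
by congr trig; apply/funext => t; rewrite /trigsum big_cons.
Qed.

Lemma L2_trigsum s (c : int -> R[i]) : L2 (trigsum s c).
Proof.
apply: trig_L2 (\max_(m <- s) `|m|%N) _ (trigsum_trig _ _ _ _) => m ms.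
exact: (@leq_bigmax_seq _ _ xpredT (fun m : int => `|m|%N)).
Qed.

Lemma L1_trigsumM s (c : int -> R[i]) f : L1 f -> L1 (fun t => trigsum s c t * f t).
Proof.
move=> [mf if_].
have [mP [B PB]] := trig_bounded _ _ (@trigsum_trig (\max_(m <- s) `|m|%N) s c
  (fun m ms => @leq_bigmax_seq _ _ xpredT (fun m : int => `|m|%N) m ms isT)).
apply: L1_le (rintegrableZ B _ if_) _ => [|t _]; first exact: cmeasurableM.
by rewrite normcM expr1 ler_wpM2r ?normc_ge0.
Qed.

Lemma fourier_trigsumM s (c : int -> R[i]) f n : L1 f ->
  fourier (fun t => trigsum s c t * f t) n = \sum_(m <- s) c m * fourier f (n - m).
Proof.
move=> f1; elim: s => [|m s IH].
  have -> : (fun t => trigsum [::] c t * f t) = (fun t => 0 * f t).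
    by apply/funext => t; rewrite /trigsum big_nil.
  by rewrite fourierZ // mul0r big_nil.
have -> : (fun t => trigsum (m :: s) c t * f t) =
    (fun t => c m * (wave m t * f t) + trigsum s c t * f t).
  by apply/funext => t; rewrite /trigsum big_cons mulrDl mulrA.
have mf1 : L1 (fun t => wave m t * f t).
  by have := L1Me _ m f1; congr L1; apply/funext => t; rewrite mulrC.
rewrite fourierD; [|exact: L1Z|exact: L1_trigsumM].
by rewrite fourierZ // IH fourierMe big_cons.
Qed.

Lemma fourier_trigsum s (c : int -> R[i]) n : uniq s ->
  fourier (trigsum s c) n = if n \in s then c n else 0.
Proof.
move=> us.
have -> : trigsum s c = (fun t => trigsum s c t * (fun=> 1) t).
  by apply/funext => t; rewrite mulr1.
rewrite fourier_trigsumM; last exact/L2_L1/L2_cst.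
have F1 k : fourier (fun=> 1 : R[i]) k = (k == 0)%:R.
  have -> : (fun=> 1) = @wave R 0 by apply/funext => t; rewrite wave0.
  by rewrite fourier_wave eq_sym.
under eq_bigr do rewrite F1 subr_eq0.
case: ifPn => ns; last first.
  rewrite big_seq big1 // => m ms.
  by rewrite (_ : n == m = false) ?mulr0 //; apply: contraNF ns => /eqP ->.
rewrite (bigD1_seq n) //= eqxx mulr1 big1 ?addr0 // => m mn.
by rewrite eq_sym (negbTE mn) mulr0.
Qed.

Definition partial_sum (N : nat) f : R -> R[i] := trigsum (freq N) (fourier f).

Lemma partial_sum_trig N f : trig N (partial_sum N f).
Proof. by apply: trigsum_trig => m; rewrite mem_freq. Qed.

Lemma L2_partial_sum N f : L2 (partial_sum N f).
Proof. exact: L2_trigsum. Qed.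

(** The partial sum has the same coefficients of index at most N in absolute value
    as f, so the difference is orthogonal to each monomial of Q. *)
Lemma orthogonal_partial_sum N f Q : L2 f -> trig N Q ->
  I (fun t => (f t - partial_sum N f t) * (Q t)^*%C) = 0.
Proof.
move=> f2; have h2 := L2B _ _ f2 (L2_partial_sum N f).
elim=> [|c n P nN tP IH].
  have -> : (fun t => (f t - partial_sum N f t) * (0 : R[i])^*%C) = (fun=> 0).
    by apply/funext => t; rewrite conjc0 mulr0.
  have := @cintegral_real R (fun=> 0).
  by rewrite Rintegral_cst ?mul0r //; exact: measurable_circle.
have -> : (fun t => (f t - partial_sum N f t) * (c * wave n t + P t)^*%C) =
    (fun t => c^*%C * ((f t - partial_sum N f t) * wave (- n) t) +
      (f t - partial_sum N f t) * (P t)^*%C).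
  by apply/funext => t; rewrite conjcD conjcM waveJ; ring.
have hP : L1 (fun t => (f t - partial_sum N f t) * (P t)^*%C).
  exact: L2M_L1 h2 (L2J _ (trig_L2 _ _ tP)).
have he := L1Me _ (- n) (L2_L1 _ h2).
rewrite cintegralD //; last exact: L1Z.
rewrite cintegralZ // IH addr0.
have : fourier (fun t => f t - partial_sum N f t) n = 0.
  rewrite fourierB; [|exact: L2_L1|exact/L2_L1/L2_partial_sum].
  by rewrite fourier_trigsum ?freq_uniq // mem_freq nN subrr.
rewrite fourierE /mean => /eqP; rewrite mulf_eq0 => /orP[|/eqP ->]; last exact: mulr0.
rewrite (_ : 0 = (0 : R)%:C) // (inj_eq (@complexI R)) invr_eq0 mulf_eq0 pnatr_eq0 /=.
by rewrite gt_eqF ?pi_gt0.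
Qed.

(** By Pythagoras the partial sum is the best approximation among the trigonometric
    polynomials of degree at most N, so density makes the error small. *)
Lemma partial_sum_cvg f (s : R) : L2 f -> 0 < s ->
  exists N0, forall N, (N0 <= N)%N -> sqrL2norm (fun t => f t - partial_sum N f t) <= s.
Proof.
move=> f2 s0; have [_ /(_ _ s0)[P [[N0 tP] fPs]]] := L2_in_closure _ f2.
exists N0 => N NN; apply: le_trans fPs.
have tQ : trig N (fun t => partial_sum N f t - P t).
  have := trigD _ _ _ (partial_sum_trig N f)
    (trigM _ _ _ _ (trig_monomial 0 (-1) 0 (leqnn _)) (trig_mono _ _ _ NN tP)).
  congr trig; apply/funext => t.
  by rewrite wave0 mulr1 mulN1r.
have := sqrL2normD _ _ (L2B _ _ f2 (L2_partial_sum N f)) (trig_L2 _ _ tQ).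
rewrite orthogonal_partial_sum // mulr0 addr0.
have -> : (fun t => f t - partial_sum N f t + (partial_sum N f t - P t)) =
  (fun t => f t - P t) by apply/funext => t; rewrite addrA subrK.
by move=> ->; rewrite lerDl sqrL2norm_ge0.
Qed.

(** When A is replaced by its partial sum, the product has exactly this finite
    convolution as coefficient; Cauchy-Schwarz controls the error. The weight w
    balances the two terms of that inequality. *)
Lemma fourierM_cvg A B n (s : R) : L2 A -> L2 B -> 0 < s ->
  exists N0, forall N, (N0 <= N)%N ->
    normc (fourier (fun t => A t * B t) n -
           \sum_(m <- freq N) fourier A m * fourier B (n - m)) <= s.
Proof.
move=> A2 B2 s0.
have b0 := sqrL2norm_ge0 B.
pose w : R := 2 * (sqrL2norm B + 1) / s.
have w0 : 0 < w by apply: divr_gt0 => //; lra.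
have [N0 HN] := partial_sum_cvg _ (s / (2 * w)) A2 (divr_gt0 s0 (mulr_gt0 (ltr0n _ 2) w0)).
exists N0 => N /HN hN.
have h2 := L2B _ _ A2 (L2_partial_sum N A).
rewrite -fourier_trigsumM; last exact: L2_L1.
rewrite -fourierB; [|exact: L2M_L1|exact: L2M_L1 (L2_trigsum _ _) B2].
rewrite fourierE; apply: le_trans (normc_mean_le _) _.
have -> : (fun t => (A t * B t - trigsum (freq N) (fourier A) t * B t) * wave (- n) t) =
    (fun t => (A t - partial_sum N A t) * (B t * wave (- n) t)).
  by apply/funext => t; rewrite /partial_sum; ring.
apply: le_trans (normc_cintegralM_le _ _ _ w0 h2 (L2Me _ (- n) B2)) _.
have -> : sqrL2norm (fun t => B t * wave (- n) t) = sqrL2norm B.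
  by apply: eq_Rintegral => t _; rewrite normcM normc_wave mulr1.
have h1 : w * sqrL2norm (fun t => A t - partial_sum N A t) <= s / 2.
  move: hN; rewrite ler_pdivlMr; last by lra.
  lra.
have h3 : w^-1 * sqrL2norm B <= s / 2.
  rewrite mulrC ler_pdivrMr //.
  have -> : s / 2 * w = sqrL2norm B + 1 by rewrite /w; field; rewrite gt_eqF.
  lra.
lra.
Qed.

(** In the partial order of the complex numbers, an upper bound of a modulus is a
    nonnegative real. So [maj f f] means that f has nonnegative coefficients. *)
Definition maj f g : Prop := forall n, `|fourier f n| <= fourier g n.

Lemma maj_refl f : (forall n, 0 <= fourier f n) -> maj f f.
Proof. by move=> f0 n; rewrite ger0_norm. Qed.

Lemma maj_ge0 f g n : maj f g -> 0 <= fourier g n.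
Proof. by move=> fg; exact: le_trans (normr_ge0 _) (fg n). Qed.

(** Finite convolutions are compared term by term, and both converge to the
    coefficients of the products. *)
Lemma majM A A' B B' : L2 A -> L2 A' -> L2 B -> L2 B' ->
  maj A A' -> maj B B' -> maj (fun t => A t * B t) (fun t => A' t * B' t).
Proof.
move=> A2 A2' B2 B2' mA mB n; apply: ler_norm_lim => s s0.
have [K1 H1] := fourierM_cvg _ _ n _ A2 B2 s0.
have [K2 H2] := fourierM_cvg _ _ n _ A2' B2' s0.
exists (\sum_(m <- freq (maxn K1 K2)) fourier A m * fourier B (n - m)).
exists (\sum_(m <- freq (maxn K1 K2)) fourier A' m * fourier B' (n - m)).
split; [|by apply: H1; rewrite leq_maxl|by apply: H2; rewrite leq_maxr].
apply: le_trans (ler_norm_sum _ _ _) _; apply: ler_sum => m _.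
by rewrite normrM ler_pM // ?mA ?mB.
Qed.

Lemma conjc_ge0_id c : 0 <= c -> c^*%C = c.
Proof. by move=> c0; apply: complexP; rewrite ?reJ ?imJ // (ger0_Im c0) oppr0. Qed.

Lemma majJ A B : L1 A -> L1 B -> maj A B ->
  maj (fun t => (A t)^*%C) (fun t => (B t)^*%C).
Proof.
move=> A1 B1 AB n; rewrite !fourierJ // (conjc_ge0_id _ (maj_ge0 _ _ _ AB)).
by rewrite normr_normc normc_conj -normr_normc.
Qed.

Lemma majX A B k : (forall i, (i <= k)%N -> L2 (fun t => A t ^+ i)) ->
  (forall i, (i <= k)%N -> L2 (fun t => B t ^+ i)) ->
  maj A B -> maj (fun t => A t ^+ k) (fun t => B t ^+ k).
Proof.
elim: k => [_ _ _|k IH A2 B2 AB].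
  apply: maj_refl => n.
  have -> : (fun t => B t ^+ 0) = wave 0 by apply/funext => t; rewrite wave0.
  by rewrite fourier_wave; case: (_ == _).
have -> : (fun t => A t ^+ k.+1) = (fun t => A t * A t ^+ k).
  by apply/funext => t; rewrite exprS.
have -> : (fun t => B t ^+ k.+1) = (fun t => B t * B t ^+ k).
  by apply/funext => t; rewrite exprS.
apply: majM => //.
- exact: (A2 1%N).
- exact: (B2 1%N).
- exact: A2 (leqnSn _).
- exact: B2 (leqnSn _).
by apply: IH => // i ik; [apply: A2|apply: B2]; exact: leqW.
Qed.

Lemma maj_trigsum s (c : int -> R[i]) f : uniq s -> (forall n, `|c n| <= fourier f n) ->
  maj (trigsum s c) f.
Proof.
move=> us cf n; rewrite fourier_trigsum //; case: ifP => _ //.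
by rewrite normr0; exact: le_trans (normr_ge0 _) (cf n).
Qed.

End FourierCoefficients.

(** * The dual majorant inequality *)

Section DualMajorant.
Import ComplexField.Normc.
Import numFieldNormedType.Exports.
Local Open Scope complex_scope.
Local Open Scope classical_set_scope.
Context {R : realType}.
Implicit Types (f g G : R -> R[i]) (p : R).

Local Notation mu := (@lebesgue_measure R).
Local Notation D := (@circle R).

Lemma mean_mulJ_trigsum f s (c : int -> R[i]) : L1 f ->
  mean (fun t => f t * (trigsum s c t)^*%C) = \sum_(n <- s) (c n)^*%C * fourier f n.
Proof.
move=> f1; have fJ1 : L1 (fun t => (f t)^*%C).
  by case: f1 => mf if_; apply: L1_le if_ _ => [|t _];
    [exact: cmeasurableJ|rewrite normc_conj].
have -> : (fun t => f t * (trigsum s c t)^*%C) =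
    (fun t => (trigsum s c t * (f t)^*%C)^*%C).
  by apply/funext => t; rewrite conjcM conjcK mulrC.
rewrite -fourier0 fourierJ; last exact: L1_trigsumM.
rewrite oppr0 fourier_trigsumM //.
have conj_sum (l : seq int) (z : int -> R[i]) :
    (\sum_(n <- l) z n)^*%C = \sum_(n <- l) (z n)^*%C by exact: rmorph_sum.
rewrite conj_sum; apply: eq_bigr => n _.
by rewrite conjcM fourierJ // sub0r opprK conjcK.
Qed.

Lemma cvg_finite_sum (s : seq int) (b a : int -> R[i]) (a_ : nat -> int -> R[i]) :
  (forall m (w : R), 0 < w -> exists N0, forall N, (N0 <= N)%N ->
     normc (a m - a_ N m) <= w) ->
  forall w : R, 0 < w -> exists N0, forall N, (N0 <= N)%N ->
    normc (\sum_(m <- s) b m * a m - \sum_(m <- s) b m * a_ N m) <= w.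
Proof.
move=> H; elim: s => [|m s IH] w w0.
  by exists 0%N => N _; rewrite !big_nil subrr normc0 ltW.
have w2 : 0 < w / 2 by lra.
have k0 : 0 < normc (b m) + 1 by have := normc_ge0 (b m); lra.
have [K1 H1] := IH _ w2; have [K2 H2] := H m _ (divr_gt0 w2 k0).
exists (maxn K1 K2) => N; rewrite geq_max => /andP[/H1 h1 /H2 h2].
rewrite !big_cons opprD addrACA -mulrBr.
apply: le_trans (normc_triangle _ _) _; rewrite normcM.
move: h2; rewrite ler_pdivlMr //.
by have := normc_ge0 (a m - a_ N m); have := normc_ge0 (b m); lra.
Qed.

(** Division by zero yields the phase 0 at 0, for which [phaseJ_mul] still holds. *)
Definition phase (z : R[i]) : R[i] := z / `|z|.

Lemma norm_phase_le z : `|phase z| <= 1.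
Proof.
rewrite normrM normfV normr_id; have [->|z0] := eqVneq z 0.
  by rewrite normr0 mul0r ler01.
by rewrite divff ?normr_eq0.
Qed.

Lemma phaseJ_mul z : (phase z)^*%C * z = `|z|.
Proof.
have [->|z0] := eqVneq z 0; first by rewrite mulr0 normr0.
rewrite /phase conjcM conjc_inv (conjc_ge0_id (`|z|)) ?normr_ge0 //.
rewrite mulrAC mulrC -[z^*%C * z]mulrC mulcJ_normc normr_normc rmorphXn.
by rewrite expr2 mulrA mulVf ?mul1r // -normr_normc normr_eq0.
Qed.

Lemma mean_normc_exp f j : mean (fun t => f t ^+ j * (f t ^+ j)^*%C) =
  ((2 * pi)^-1 * \int[mu]_(t in D) normc (f t) ^+ (2 * j))%:C.
Proof.
rewrite realcM -cintegral_real /mean; congr (_ * cintegral _ _).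
by apply/funext => t; rewrite mulcJ_normc normcX -exprM mulnC.
Qed.

Lemma expr_le1D (x : R) m n : 0 <= x -> (m <= n)%N -> x ^+ m <= 1 + x ^+ n.
Proof.
move=> x0 mn; have [x1|x1] := leP x 1.
  by apply: le_trans (exprn_ile1 _ x0 x1) _; rewrite lerDl exprn_ge0.
by apply: le_trans (ler_weXn2l (ltW x1) mn) _; rewrite lerDr.
Qed.

Lemma L2X G j k : cmeasurable G -> rintegrable (fun t => normc (G t) ^+ (2 * j)) ->
  (k <= j)%N -> L2 (fun t => G t ^+ k).
Proof.
move=> mG iG kj; apply: integrable_pow_le (rintegrableD _ _ (rintegrable_cst 1) iG) _.
  exact: cmeasurableX.
move=> t _; rewrite normcX -exprM mulnC; apply: expr_le1D; first exact: normc_ge0.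
by rewrite leq_mul2l kj.
Qed.

Lemma L1_of_powR f p : 1 <= p -> cmeasurable f ->
  rintegrable (fun t => normc (f t) `^ p) -> L1 f.
Proof.
move=> p1 mf iff; apply: L1_le (rintegrableD _ _ (rintegrable_cst 1) iff) _ => // t _.
have [x1|x1] := leP (normc (f t)) 1.
  by apply: le_trans x1 _; rewrite lerDl powR_ge0.
rewrite -[leLHS]powRr1 ?normc_ge0 //.
by apply: le_trans (ler_powR (ltW x1) p1) _; rewrite lerDr.
Qed.

(** Young's inequality takes the place of Hoelder's: as the weights 1/p and 1/q add
    up to 1, the norms compared at the end can be extracted without taking roots. *)
Lemma young_mean_le f g p (q : nat) :
  cmeasurable f -> cmeasurable g -> 0 < p -> (0 < q)%N -> p^-1 + q%:R^-1 = 1 ->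
  rintegrable (fun t => normc (f t) `^ p) -> rintegrable (fun t => normc (g t) ^+ q) ->
  normc (mean (fun t => f t * (g t)^*%C)) <= (2 * pi)^-1 *
    ((\int[mu]_(t in D) normc (f t) `^ p) / p +
     (\int[mu]_(t in D) normc (g t) ^+ q) / q%:R).
Proof.
move=> mf mg p0 q0 pq if_ ig.
have iY := rintegrableD _ _ (rintegrableZ p^-1 _ if_) (rintegrableZ q%:R^-1 _ ig).
have young t : normc (f t * (g t)^*%C) <=
    p^-1 * normc (f t) `^ p + q%:R^-1 * normc (g t) ^+ q.
  rewrite normcM normc_conj -powR_mulrn ?normc_ge0 //.
  rewrite ![_^-1 * _]mulrC.
  by apply: conjugate_powR; rewrite ?normc_ge0 ?ltr0n.
have fg1 : L1 (fun t => f t * (g t)^*%C).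
  by apply: L1_le iY _ => // ; apply: cmeasurableM => //; exact: cmeasurableJ.
have pi0 : 0 <= (2 * pi : R)^-1 by rewrite invr_ge0 mulr_ge0 ?pi_ge0.
rewrite normcM normc_real ger0_norm // ler_wpM2l //.
apply: le_trans (normc_cintegral_le _ fg1) _.
rewrite ![_ / _]mulrC -!RintegralZl //; [|exact: measurable_circle..].
rewrite -RintegralD //; [|exact: measurable_circle|exact: rintegrableZ..].
apply: le_Rintegral => //; first exact: measurable_circle.
exact: L1_normc.
Qed.

(** With q = 2 j and g a partial sum of G whose coefficients are turned by the phases
    of those of f, the chain of inequalities is
      sum F^ G^ <= sum |f^| G^ = <f, g> <= J / p + |g|_q^q / q <= J / p + I / q,
    sums being over the frequencies of g. The left-hand side is compared with I by
    positivity and a double limit. *)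
Lemma dual_majorant G f (j : nat) p : (0 < j)%N -> 1 <= p ->
  p^-1 + (2 * j)%:R^-1 = 1 ->
  cmeasurable G -> rintegrable (fun t => normc (G t) ^+ (2 * j)) ->
  cmeasurable f -> rintegrable (fun t => normc (f t) `^ p) ->
  (forall n : int, 0 <= fourier G n) ->
  (forall n : int, fourier G n != 0 ->
    fourier (fun t => (G t)^*%C ^+ (j - 1) * G t ^+ j) n <= `|fourier f n|) ->
  \int[mu]_(t in D) normc (G t) ^+ (2 * j) <= \int[mu]_(t in D) normc (f t) `^ p.
Proof.
move=> j0 p1 pq mG iG mf if_ G0 Ff.
set F := (fun t => _) in Ff.
set Iq := \int[mu]_(t in D) normc (G t) ^+ (2 * j).
set J := \int[mu]_(t in D) normc (f t) `^ p.
have p0 : 0 < p by lra.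
have k0 : 0 < (2 * pi : R)^-1 by rewrite invr_gt0 mulr_gt0 ?pi_gt0.
have f1 : L1 f by exact: L1_of_powR if_.
have GX k : (k <= j)%N -> L2 (fun t => G t ^+ k) by exact: L2X.
have G2 : L2 G by have := GX 1%N j0.
have majG : maj G G by exact: maj_refl.
have majGX k : (k <= j)%N -> maj (fun t => G t ^+ k) (fun t => G t ^+ k).
  by move=> kj; apply: majX => // i ik; apply: GX; exact: leq_trans kj.
have GX1 := GX _ (leq_subr 1 j); have GXj := GX _ (leqnn j).
pose K : R := (2 * pi)^-1 * (J / p + Iq / (2 * j)%:R).
pose c n := phase (fourier f n) * fourier G n.
(* The partial sums of G twisted by phases are majorized by G, hence so are their
   powers, and their norms of exponent 2 j are at most that of G. *)
have young N : normc (mean (fun t => f t * (trigsum (freq N) c t)^*%C)) <= K.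
  set g := trigsum _ _.
  have [mg [B gB]] : cmeasurable g /\ exists B : R, forall t, normc (g t) <= B.
    by apply: (@trig_bounded _ N); apply: trigsum_trig => m; rewrite mem_freq.
  have ig : rintegrable (fun t => normc (g t) ^+ (2 * j)).
    apply: rintegrable_le (rintegrable_cst (B ^+ (2 * j))) _ => [|t _].
      by apply: measurable_funX; exact: cmeasurable_normc.
    by rewrite ger0_norm ?exprn_ge0 ?normc_ge0 // lerXn2r ?nnegrE ?normc_ge0 //
      (le_trans (normc_ge0 (g t))).
  have q0 : (0 < 2 * j)%N by rewrite muln_gt0.
  apply: le_trans (young_mean_le _ _ _ _ mf mg p0 q0 pq if_ ig) _.
  rewrite ler_pM2l // lerD2l ler_pM2r ?invr_gt0 ?ltr0n //.
  have mgG : maj g G.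
    apply: maj_trigsum (freq_uniq N) _ => n; rewrite normrM.
    by rewrite (ger0_norm (G0 n)) ler_piMl ?norm_phase_le.
  have gX k : (k <= j)%N -> L2 (fun t => g t ^+ k) by exact: L2X.
  have mX : maj (fun t => g t ^+ j) (fun t => G t ^+ j) by exact: majX.
  have gj := gX j (leqnn j).
  have mXJ := majJ _ _ (L2_L1 _ gj) (L2_L1 _ GXj) mX.
  have := majM _ _ _ _ gj GXj (L2J _ gj) (L2J _ GXj) mX mXJ 0.
  rewrite !fourier0 !mean_normc_exp normr_normc lecR normc_real.
  by move=> /(le_trans (ler_norm _)); rewrite ler_pM2l.
have F1 : L1 F.
  have := L2M_L1 _ _ (L2J _ GX1) GXj; congr L1; apply/funext => t.
  by rewrite /F; congr (_ * _); exact: rmorphXn.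
have sumF N : \sum_(n <- freq N) fourier G n * fourier F n <= K%:C.
  apply: (@le_trans _ _ (\sum_(n <- freq N) (c n)^*%C * fourier f n)).
    apply: ler_sum => n _; rewrite /c conjcM (conjc_ge0_id _ (G0 n)).
    rewrite [leRHS]mulrAC phaseJ_mul mulrC.
    have [->|Gn0] := eqVneq (fourier G n) 0; first by rewrite !mulr0.
    by rewrite ler_wpM2r // Ff.
  have c0 : 0 <= \sum_(n <- freq N) (c n)^*%C * fourier f n.
    apply: sumr_ge0 => n _; rewrite /c conjcM (conjc_ge0_id _ (G0 n)).
    by rewrite mulrAC phaseJ_mul mulr_ge0.
  rewrite -(ger0_norm c0) -mean_mulJ_trigsum // normr_normc lecR.
  exact: young.
pose b m := fourier (fun t => G t ^+ j) m.
have b0 m : 0 <= b m := maj_ge0 _ _ m (majGX j (leqnn j)).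
pose H N t := G t ^+ (j - 1) * partial_sum N G t.
have SB N : cmeasurable (partial_sum N G) /\
    exists B : R, forall t, normc (partial_sum N G t) <= B.
  exact: trig_bounded _ _ (partial_sum_trig N G).
have H2 N : L2 (H N).
  have [mS [B SB']] := SB N.
  have := L2_boundedM _ _ B mS (fun t _ => SB' t) GX1.
  by congr L2; apply/funext => t; rewrite mulrC.
have majS N : maj (partial_sum N G) G.
  by apply: maj_trigsum (freq_uniq N) _ => n; exact: majG.
have majSS N : maj (partial_sum N G) (partial_sum N G).
  apply: maj_refl => n; rewrite fourier_trigsum ?freq_uniq //.
  by case: ifP.
have majHH N : maj (H N) (H N).
  by apply: majM => //; [exact: L2_partial_sum..|exact: majGX (leq_subr _ _)].
have bH N m : 0 <= fourier (H N) m := maj_ge0 _ _ m (majHH N).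
(* By positivity, truncating G ^ j to frequencies at most M only lowers its pairing
   with H N; and moving powers of G from one factor to the other turns the
   untruncated pairing into that of F with a partial sum of G. *)
have pair M N : \sum_(m <- freq M) b m * fourier (H N) m <= K%:C.
  have HJ1 := L2_L1 _ (L2J _ (H2 N)).
  have -> : \sum_(m <- freq M) b m * fourier (H N) m =
      fourier (fun t => trigsum (freq M) b t * (H N t)^*%C) 0.
    rewrite fourier_trigsumM //; apply: eq_bigr => m _.
    rewrite (fourierJ (H N)); last exact: L2_L1.
    by rewrite sub0r opprK conjc_ge0_id.
  apply: le_trans (sumF N).
  have -> : \sum_(n <- freq N) fourier G n * fourier F n =
      fourier (fun t => G t ^+ j * (H N t)^*%C) 0.
    rewrite fourier0.
    have -> : (fun t => G t ^+ j * (H N t)^*%C) =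
        (fun t => F t * (partial_sum N G t)^*%C).
      apply/funext => t; rewrite /H /F conjcM mulrA [G t ^+ j * _]mulrC.
      by congr (_ * _ * _); exact: rmorphXn.
    rewrite mean_mulJ_trigsum //; apply: eq_bigr => n _.
    by rewrite conjc_ge0_id.
  have mb : maj (trigsum (freq M) b) (fun t => G t ^+ j).
    by apply: maj_trigsum (freq_uniq M) _ => m; rewrite ger0_norm.
  have mHJ := majJ _ _ (L2_L1 _ (H2 N)) (L2_L1 _ (H2 N)) (majHH N).
  have := majM _ _ _ _ (L2_trigsum _ _) GXj (L2J _ (H2 N)) (L2J _ (H2 N)) mb mHJ 0.
  apply: le_trans; apply: real_ler_norm; apply: ger0_real.
  rewrite fourier_trigsumM //; apply: sumr_ge0 => m _.
  rewrite (fourierJ (H N)); last exact: L2_L1.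
  by rewrite mulr_ge0 // conj_ge0.
have bH_cvg m (w : R) : 0 < w -> exists N0, forall N, (N0 <= N)%N ->
    normc (b m - fourier (H N) m) <= w.
  move=> w0; have [N0 HN] := fourierM_cvg _ _ m _ G2 GX1 w0.
  exists N0 => N /HN; congr (normc (_ - _) <= _).
    by congr (fourier _ m); apply/funext => t; rewrite -exprS subn1 prednK.
  rewrite -fourier_trigsumM; last exact: L2_L1.
  by congr (fourier _ m); apply/funext => t; rewrite mulrC.
have sumb M : \sum_(m <- freq M) b m * b m <= K%:C.
  have bb0 : 0 <= \sum_(m <- freq M) b m * b m.
    by apply: sumr_ge0 => m _; rewrite mulr_ge0.
  rewrite -(ger0_norm bb0); apply: ler_norm_lim => w w0.
  have [N0 HN] := cvg_finite_sum (freq M) b _ _ bH_cvg _ w0.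
  exists (\sum_(m <- freq M) b m * fourier (H N0) m), K%:C; split.
  - rewrite ger0_norm ?pair //.
    by apply: sumr_ge0 => m _; rewrite mulr_ge0.
  - exact: HN.
  - by rewrite subrr normc0 ltW.
have IqK : (2 * pi)^-1 * Iq <= K.
  rewrite -lecR -mean_normc_exp -fourier0.
  have real0 : 0 <= fourier (fun t => G t ^+ j * (G t ^+ j)^*%C) 0.
    rewrite fourier0 mean_normc_exp ler0c mulr_ge0 ?(ltW k0) //.
    by apply: Rintegral_ge0 => t _; rewrite exprn_ge0 ?normc_ge0.
  rewrite -(ger0_norm real0); apply: ler_norm_lim => w w0.
  have [N0 HN] := fourierM_cvg _ _ 0 _ GXj (L2J _ GXj) w0.
  exists (\sum_(m <- freq N0) b m * b m), K%:C; split.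
  - rewrite ger0_norm ?sumb //.
    by apply: sumr_ge0 => m _; rewrite mulr_ge0.
  - have := HN N0 (leqnn _); congr (normc (_ - _) <= _).
    apply: eq_bigr => m _; rewrite fourierJ; last exact: L2_L1.
    by rewrite sub0r opprK conjc_ge0_id.
  - by rewrite subrr normc0 ltW.
move: IqK; rewrite /K ler_pM2l //.
have -> : (2 * j)%:R^-1 = 1 - p^-1 :> R by lra.
have pi0 : 0 < p^-1 by rewrite invr_gt0.
by move=> h; rewrite -(ler_pM2r pi0); lra.
Qed.

Lemma inLp_integrable p f : 0 < p -> inLp p f ->
  cmeasurable f /\ rintegrable (fun t => normc (f t) `^ p).
Proof.
move=> p0 [_ m1 m2 foo]; have mf : cmeasurable f by split.
have mfp : measurable_fun D (fun t => normc (f t) `^ p).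
  by apply: (measurableT_comp (measurable_powR p)); exact: cmeasurable_normc.
split=> //; apply/integrableP; split; first exact/measurable_EFinP.
rewrite (_ : (fun _ => _) = (fun t => (normc (f t) `^ p)%:E)); last first.
  by apply/funext => t /=; rewrite ger0_norm ?powR_ge0.
rewrite ltNge; apply/negP; rewrite leye_eq => /eqP Ioo; move: foo.
rewrite /cLnorm Ioo gt0_muley ?lte_fin ?invr_gt0 ?mulr_gt0 ?pi_gt0 //.
by rewrite poweRyr ?ltxx // gt_eqF ?invr_gt0.
Qed.

Lemma cLnorm_le p f g : 0 < p ->
  rintegrable (fun t => normc (f t) `^ p) -> rintegrable (fun t => normc (g t) `^ p) ->
  \int[mu]_(t in D) normc (f t) `^ p <= \int[mu]_(t in D) normc (g t) `^ p ->
  (cLnorm p f <= cLnorm p g)%E.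
Proof.
move=> p0 if_ ig fg.
have i0 (h : R -> R[i]) : (0 <= \int[mu]_(t in D) (normc (h t) `^ p)%:E)%E.
  by apply: integral_ge0 => t _; rewrite lee_fin powR_ge0.
have k0 : (0 <= ((2 * pi : R)^-1)%:E)%E.
  by rewrite lee_fin invr_ge0 mulr_ge0 ?pi_ge0.
have in0y (z : \bar R) : (0 <= z)%E -> z \in Interval (BLeft 0%E) (BRight +oo%E).
  by move=> z0; rewrite in_itv /= z0 leey.
apply: gt0_ler_poweR.
- by rewrite invr_ge0 ltW.
- by apply: in0y; exact: mule_ge0.
- by apply: in0y; exact: mule_ge0.
apply: lee_wpmul2l => //.
by move: fg; rewrite -lee_fin /Rintegral !fineK //;
  apply: integrable_fin_num => //; exact: measurable_circle.
Qed.

End DualMajorant.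

Theorem theorem1p4 (R : realType) (j : nat) (hj : (1 < j)%N)
    (p : R) (hp : p = (2 * j)%:R / (2 * j - 1)%:R)
    (G : R -> R[i]) (hG : inLp (2 * j)%:R G)
    (hGcoef : forall n : int, 0 <= fourier G n)
    (F : R -> R[i])
    (hF : F = fun t => ((G t)^*)%C ^+ (j - 1) * G t ^+ j)
    (f : R -> R[i]) (hf : inLp p f)
    (hfcoef : forall n : int, fourier G n != 0 -> fourier F n <= `|fourier f n|) :
  (cLnorm p F <= cLnorm p f)%E.
Proof.
have j0 : (0 < j)%N by exact: ltnW.
have q1 : 1 < (2 * j)%:R :> R by rewrite ltr1n; lia.
have pE : p = (2 * j)%:R / ((2 * j)%:R - 1) by rewrite hp natrB ?muln_gt0.
have p1 : 1 <= p by rewrite pE ler_pdivlMr; lra.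
have p0 : 0 < p by lra.
have pq : p^-1 + (2 * j)%:R^-1 = 1.
  by rewrite pE; field; apply/andP; split; rewrite gt_eqF //; lra.
have [mf if_] := inLp_integrable _ _ p0 hf.
have q0 : 0 < (2 * j)%:R :> R by lra.
have [mG iG'] := inLp_integrable _ _ q0 hG.
have iG : rintegrable (fun t => ComplexField.Normc.normc (G t) ^+ (2 * j)).
  move: iG'; congr rintegrable; apply/funext => t.
  by rewrite powR_mulrn ?normc_ge0.
have FG t : ComplexField.Normc.normc (F t) `^ p =
    ComplexField.Normc.normc (G t) ^+ (2 * j).
  rewrite hF ComplexField.Normc.normcM !normcX normc_conj -exprD.
  have -> : (j - 1 + j = 2 * j - 1)%N by lia.
  rewrite -!powR_mulrn ?normc_ge0 // -powRrM hp mulrCA divff ?mulr1 //.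
  by rewrite pnatr_eq0; lia.
have EF : (fun t => ComplexField.Normc.normc (F t) `^ p) =
    (fun t => ComplexField.Normc.normc (G t) ^+ (2 * j)) by apply/funext.
apply: cLnorm_le => //; rewrite EF //.
by apply: dual_majorant => // n; rewrite -hF; exact: hfcoef.
Qed.
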